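(* Let $R$ be an arbitrary ordered set. There exists a one-sided error, non-adaptive tester for unateness of functions $f:\{0,1\}^n \to R$ whose running time (and in particular number of queries) is $O\big((n/\varepsilon)\log(n/\varepsilon)\big)$. That is, there is a randomized algorithm which, given $n$, a proximity parameter $\varepsilon \in (0,1)$, and query access to $f:\{0,1\}^n\to R$, chooses all its queries before seeing any answers, runs in time $O((n/\varepsilon)\log(n/\varepsilon))$, always accepts if $f$ is unate, and rejects with probability at least a positive constant (e.g. at least $2/3$ after constant-factor repetition) if $f$ is $\varepsilon$-far from being unate.
   Context: For $x\in\{0,1\}^n$ and $i\in[n]$, let $e_i$ be the unit vector with $1$ in coordinate $i$. The $i$-th partial derivative of $f:\{0,1\}^n\to R$ at $x$ is $\partial_i f(x) = f(x\oplus e_i)-f(x)$ if $x_i=0$ and $\partial_i f(x)= f(x)-f(x\oplus e_i)$ if $x_i=1$ (when $R$ is merely ordered, only the sign of $\partial_i f(x)$, i.e. the comparison of $f(x)$ and $f(x\oplus e_i)$, matters). A function $f$ is unate if for every $i\in[n]$, either $\partial_i f(x)\ge 0$ for all $x$, or $\partial_i f(x)\le 0$ for all $x$. The distance of $f$ to unateness is the minimum, over unate $g:\{0,1\}^n\to R$, of the fraction of points $x\in\{0,1\}^n$ with $f(x)\neq g(x)$; $f$ is $\varepsilon$-far from unate if this distance is at least $\varepsilon$. A tester is one-sided if it accepts every unate function with probability $1$, and non-adaptive if its queries do not depend on answers to previous queries. *)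

(* Defs.v *)
From mathcomp Require Import all_boot all_order all_algebra.
From mathcomp Require Import classical_sets reals exp.

Set Implicit Arguments.
Unset Strict Implicit.
Unset Printing Implicit Defensive.

Import Order.TTheory GRing.Theory Num.Theory.

Local Open Scope ring_scope.

Definition cube (n : nat) := {ffun 'I_n -> bool}.

(* flip i x is x (+) e_i *)
Definition flip (n : nat) (i : 'I_n) (x : cube n) : cube n :=
  [ffun j => x j (+) (j == i)].

Section Unateness.
Context {K : realType} {d : Order.disp_t} {R : orderType d} {n : nat}.
Implicit Types (f g : cube n -> R) (i : 'I_n) (x : cube n).

(* R carries no subtraction: only the sign of the i-th partial derivative
   makes sense, as a comparison of the two values on the edge (x, x (+) e_i). *)
Definition deriv_ge0 f i x : bool :=
  if x i then (f (flip i x) <= f x)%O else (f x <= f (flip i x))%O.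

Definition deriv_le0 f i x : bool :=
  if x i then (f x <= f (flip i x))%O else (f (flip i x) <= f x)%O.

Definition unate f : Prop :=
  forall i, (forall x, deriv_ge0 f i x) \/ (forall x, deriv_le0 f i x).

Definition hdist f g : K := #|[pred x | f x != g x]|%:R / #|{: cube n}|%:R.

(* The infimum is a minimum: constant functions are unate, and hdist takes
   finitely many values. *)
Definition unate_dist f : K := inf [set hdist f g | g in unate]%classic.

Definition unate_far (eps : K) f : Prop := eps <= unate_dist f.

End Unateness.

(* Testers are programs for a unit-cost register machine. A program is a fixed
   finite text: it depends neither on n, nor on eps, nor on f. There are four
   banks of registers, each indexed by nat, holding respectively
     - numbers, which can be added, subtracted and compared (multiplication,
       division and rounding are not primitive);
     - directions i in [n];
     - points of the cube;
     - answers to queries, which can only be compared, R being an arbitrary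
       ordered set.
   Each executed instruction, including each evaluation of the guard of a
   conditional or a loop, takes one unit of time; in particular the number of
   queries is at most the running time. As is usual when the running time of a
   tester is compared with its number of queries, a point of the cube is one
   machine word: drawing, flipping a coordinate of, and querying a point each
   take unit time. *)
Inductive cmd : Type :=
| Const (r k : nat)                  (* num r := k *)
| Add (r a b : nat)                  (* num r := num a + num b *)
| Sub (r a b : nat)                  (* num r := num a - num b *)
| RandDir (i : nat)                  (* dir i := uniform element of [n] *)
| RandPt (x : nat)                   (* pt x := uniform element of {0,1}^n *)
| Flip (y x i : nat)                 (* pt y := pt x (+) e_(dir i) *)
| Bit (r x i : nat)                  (* num r := coordinate dir i of pt x *)
| Query (v x : nat)                  (* ans v := f (pt x) *)
| IfNum (a b : nat) (p q : seq cmd)  (* if num a <= num b then p else q *)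
| IfAns (v w : nat) (p q : seq cmd)  (* if ans v <= ans w then p else q *)
| While (a b : nat) (p : seq cmd).   (* while num a < num b do p *)

Section Machine.
Context {K : realType} {d : Order.disp_t} {R : orderType d} {n : nat}.

(* One cell of the random tape; each random instruction consumes one cell and
   uses the component it needs. *)
Definition coin : finType := (cube n * 'I_n)%type.

Record state := State {
  code : seq cmd;           (* what remains to be executed *)
  tape : seq coin;          (* unread part of the random tape *)
  asked : seq (cube n);     (* queries made so far, in order *)
  num : nat -> K;
  dir : nat -> option 'I_n; (* None: not yet assigned *)
  pt : nat -> cube n;
  ans : nat -> option R     (* None: not yet assigned *)
}.

Definition ans_le (u v : option R) : bool :=
  if (u, v) is (Some a, Some b) then (a <= b)%O else false.

(* The machine has halted when no code remains. A random instruction on an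
   exhausted tape is blocked forever; see run below. *)
Definition step (f : cube n -> R) (s : state) : state :=
  let: State c w qs nm dr px an := s in
  match c with
  | [::] => s
  | Const r k :: c' => State c' w qs [eta nm with r |-> k%:R] dr px an
  | Add r a b :: c' => State c' w qs [eta nm with r |-> nm a + nm b] dr px an
  | Sub r a b :: c' => State c' w qs [eta nm with r |-> nm a - nm b] dr px an
  | RandDir i :: c' =>
      if w is z :: w' then
        State c' w' qs nm [eta dr with i |-> Some z.2] px an
      else s
  | RandPt x :: c' =>
      if w is z :: w' then State c' w' qs nm dr [eta px with x |-> z.1] an
      else s
  | Flip y x i :: c' =>
      let p := if dr i is Some j then flip j (px x) else px x in
      State c' w qs nm dr [eta px with y |-> p] an
  | Bit r x i :: c' =>
      let b := if dr i is Some j then px x j else false in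
      State c' w qs [eta nm with r |-> b%:R] dr px an
  | Query v x :: c' =>
      State c' w (rcons qs (px x)) nm dr px [eta an with v |-> Some (f (px x))]
  | IfNum a b p q :: c' =>
      State ((if nm a <= nm b then p else q) ++ c') w qs nm dr px an
  | IfAns u v p q :: c' =>
      State ((if ans_le (an u) (an v) then p else q) ++ c') w qs nm dr px an
  | While a b p :: c' =>
      State (if nm a < nm b then p ++ c else c') w qs nm dr px an
  end.

(* The inputs n and eps are in the numeric registers 0 and 1. *)
Definition init (P : seq cmd) (eps : K) (w : seq coin) : state :=
  State P w [::] [eta (fun=> 0) with 0%N |-> n%:R, 1%N |-> eps]
    (fun=> None) (fun=> [ffun=> false]) (fun=> None).

(* Execution for T steps on a random tape of T cells: a step reads at most one
   cell, so the tape cannot be exhausted before the T steps are over. *)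
Definition run (P : seq cmd) (eps : K) (f : cube n -> R)
    (T : nat) (w : T.-tuple coin) : state :=
  iter T (step f) (init P eps w).

Definition halted (s : state) : bool := nilp (code s).

(* The verdict is left in the numeric register 0: 1 means accept. *)
Definition accepts (s : state) : bool := halted s && (num s 0 == 1).
Definition rejects (s : state) : bool := halted s && (num s 0 != 1).

(* Probability over a uniformly random tape of T cells. *)
Definition Pr (T : nat) (A : pred (T.-tuple coin)) : K :=
  #|A|%:R / #|{: T.-tuple coin}|%:R.

End Machine.

Arguments coin n : clear implicits.

Section Testers.
Context {K : realType} {d : Order.disp_t} (R : orderType d).
Variables (P : seq cmd) (n : nat) (eps : K) (T : nat).
Implicit Types (f g : cube n -> R) (w : T.-tuple (coin n)).

Definition runs_in_time : Prop := forall f w, halted (run P eps f w).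

(* For given random choices, the queries do not depend on the answers. *)
Definition nonadaptive : Prop :=
  forall f g w, asked (run P eps f w) = asked (run P eps g w).

Definition one_sided : Prop :=
  forall f, unate f ->
    Pr (K := K) (fun w : T.-tuple (coin n) => accepts (run P eps f w)) = 1.

Definition rejects_far : Prop :=
  forall f, unate_far eps f ->
    2 / 3 <= Pr (K := K) (fun w : T.-tuple (coin n) =>
                            rejects (run P eps f w)).

End Testers.

(* Main.v *)
(* Structure of functions far from unate. Reorienting the cube so that in each
   direction the less frequent kind of edge is the violating one, it suffices to
   bound the distance of f to monotonicity by (a constant times) the number V of
   violated edges. Replace f by an integer ranking F that breaks ties upwards, and
   choose a charge c : {0,1}^n -> {-1,0,1} of total 0 whose mass on every upset
   is <= 0 (a fractional matching of the violation order, seen through its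
   marginals), maximising sum c F. Moving one unit of charge shows that f is
   monotone off the support of c, and that an edge u < v with F u < F v,
   c u >= 0 >= c v is cut by a tight upset (one of mass 0). Tight upsets form a
   lattice; summing over the classes of points they do not separate, the edges
   they cut contribute nothing to the mass crossing a direction, which is
   therefore at most the number of violated edges of that direction. Applying the upset
   condition to {|x| > j} plus the positive points of the layer |x| = j bounds the
   support by the total crossing mass, hence by 2 V.

   The tester. If f is eps-far from unate, the rates m_i at which both kinds of
   edges occur in direction i sum to at least eps / 2. For k = 1, 2, 4, ... up to
   about n / eps, the tester runs about n / (eps k) trials, each of which draws a
   direction and k points; direction i is caught at the scale k ~ 1 / m_i, and
   all scales together give an expected number >= 2 of rejecting trials. *)

Require Import Defs.
From mathcomp Require Import all_boot all_order all_algebra.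
From mathcomp Require Import reals exp.
From mathcomp Require Import zify ring lra.

Set Implicit Arguments.
Unset Strict Implicit.
Unset Printing Implicit Defensive.

Import Order.TTheory GRing.Theory Num.Theory.
Local Open Scope ring_scope.

(** * Monotonicity violations of functions on the cube *)

Lemma Posz_sum (I : Type) (r : seq I) (P : pred I) (G : I -> nat) :
  (\sum_(j <- r | P j) G j)%N%:Z = \sum_(j <- r | P j) (G j)%:Z.
Proof. exact: (big_morph Posz PoszD (erefl 0%:Z)). Qed.

Lemma Posz_card (T : finType) (P : pred T) :
  #|[set x | P x]|%:Z = \sum_x (P x)%:Z.
Proof.
rewrite -sum1_card Posz_sum big_mkcond /=; apply: eq_bigr => x _.
by rewrite inE; case: (P x).
Qed.

(** * The product order on the cube, and its upsets *)

Section CubeOrder.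
Variable n : nat.
Implicit Types (x y z u v : cube n) (i : 'I_n) (A B : {set cube n}).

Definition cube_le x y := [forall i, x i ==> y i].

Lemma cube_leP x y : reflect (forall i, x i -> y i) (cube_le x y).
Proof. by apply: (iffP forallP) => h i; apply/implyP; apply: h. Qed.

Lemma cube_le_refl x : cube_le x x.
Proof. exact/cube_leP. Qed.

Lemma cube_le_trans y x z : cube_le x y -> cube_le y z -> cube_le x z.
Proof.
by move=> /cube_leP xy /cube_leP yz; apply/cube_leP => i /xy /yz.
Qed.

Lemma flipE i x j : flip i x j = x j (+) (j == i).
Proof. by rewrite ffunE. Qed.

Lemma flip_diag i x : flip i x i = ~~ x i.
Proof. by rewrite flipE eqxx addbT. Qed.

Lemma flipK i : involutive (flip i : cube n -> cube n).
Proof. by move=> x; apply/ffunP => j; rewrite !flipE -addbA addbb addbF. Qed.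

Lemma flip_neq i x : flip i x != x.
Proof.
by apply/eqP => /(congr1 (fun y : cube n => y i)); rewrite flip_diag; case: (x i).
Qed.

Lemma cube_le_flip i x : ~~ x i -> cube_le x (flip i x).
Proof.
move=> xi; apply/cube_leP => j xj; rewrite flipE xj.
by case: eqP => // ji; rewrite -ji xj in xi.
Qed.

Lemma cube_le_flip_upper i x y : ~~ x i -> y i -> cube_le x y -> cube_le (flip i x) y.
Proof.
move=> xi yi /cube_leP xy; apply/cube_leP => j; rewrite flipE.
by case: eqP => [-> //|_]; rewrite addbF => /xy.
Qed.

Lemma cube_le_flip_lower i x y : ~~ x i -> y i -> cube_le x y -> cube_le x (flip i y).
Proof.
move=> xi yi /cube_leP xy; apply/cube_leP => j xj; rewrite flipE xy //.
by case: eqP => // ji; rewrite -ji xj in xi.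
Qed.

Lemma cube_le_flip2 i x y : x i = y i -> cube_le x y -> cube_le (flip i x) (flip i y).
Proof.
move=> xyi /cube_leP xy; apply/cube_leP => j; rewrite !flipE.
by case: eqP => [->|_]; [rewrite xyi | rewrite !addbF; apply: xy].
Qed.

Definition wt x : nat := \sum_i x i.

Lemma wt_le x y : cube_le x y -> (wt x <= wt y)%N.
Proof.
by move=> /cube_leP xy; apply: leq_sum => i _; case: (x i) (xy i) => // ->.
Qed.

Lemma wt_lt x y : cube_le x y -> x != y -> (wt x < wt y)%N.
Proof.
move=> xy; rewrite ltn_neqAle wt_le // andbT; apply: contra => /eqP e.
apply/eqP/ffunP => i; apply/eqP.
have /cube_leP xy' := xy.
have le j : true -> (x j <= y j)%N by move=> _; case: (x j) (xy' j) => // ->.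
have := leqif_sum (P := predT) (fun j _ => leqif_eq (le j isT)).
move=> [_]; rewrite -/(wt x) -/(wt y) e eqxx => /esym/forallP/(_ i) /=.
by case: (x i) (y i) => [] [].
Qed.

Lemma wt_max x : (wt x <= n)%N.
Proof.
rewrite -[leqRHS]card_ord -sum1_card.
by apply: leq_sum => i _; exact: leq_b1.
Qed.

Definition upset A := [forall x in A, forall y, cube_le x y ==> (y \in A)].

Lemma upsetP A :
  reflect (forall x y, x \in A -> cube_le x y -> y \in A) (upset A).
Proof.
apply: (iffP forall_inP) => [h x y xA xy|h x xA].
  by have /forallP/(_ y)/implyP := h x xA; apply.
by apply/forallP => y; apply/implyP; apply: h xA.
Qed.

Lemma upsetU A B : upset A -> upset B -> upset (A :|: B).
Proof.
move=> /upsetP uA /upsetP uB; apply/upsetP => x y; rewrite !inE.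
by case/orP => xA xy; [rewrite (uA x y) | rewrite (uB x y) ?orbT].
Qed.

Lemma upsetI A B : upset A -> upset B -> upset (A :&: B).
Proof.
move=> /upsetP uA /upsetP uB; apply/upsetP => x y; rewrite !inE.
by case/andP => xA xB xy; rewrite (uA x y) // (uB x y).
Qed.

Lemma upset0 : upset set0.
Proof. by apply/upsetP => x y; rewrite inE. Qed.

Lemma upsetT : upset setT.
Proof. by apply/upsetP => x y; rewrite !inE. Qed.

(** * Charges, tight upsets and hulls *)

Section Charge.
Variable c : cube n -> int.

Definition mass A : int := \sum_(x in A) c x.

Lemma massE A : mass A = \sum_x c x * (x \in A)%:Z.
Proof.
rewrite /mass big_mkcond; apply: eq_bigr => x _.
by case: (x \in A); rewrite ?mulr1 ?mulr0.
Qed.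

(** The upset condition is Hall's condition for matching each positive point to a negative point
    above it. *)
Record feasible : Prop := Feasible {
  feasible_bound : forall x, -1 <= c x <= 1;
  feasible_upset : forall A, upset A -> mass A <= 0;
  feasible_total : mass setT = 0 }.

Lemma mass0 : mass set0 = 0.
Proof. by rewrite /mass big_set0. Qed.

Lemma massUI A B : mass (A :|: B) + mass (A :&: B) = mass A + mass B.
Proof.
have E X : mass X = \sum_x (if x \in X then c x else 0) by rewrite /mass big_mkcond.
rewrite !E -big_split -[RHS]big_split /=; apply: eq_bigr => x _.
by rewrite !inE; case: (x \in A); case: (x \in B); rewrite ?addr0 ?add0r.
Qed.

Lemma mass_disjointU A B : [disjoint A & B] -> mass (A :|: B) = mass A + mass B.
Proof. by rewrite -massUI -setI_eq0 => /eqP ->; rewrite mass0 addr0. Qed.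

Hypothesis fc : feasible.

Definition tight A := upset A && (mass A == 0).

(** By modularity the two masses add up to 0, and neither is positive. *)
Lemma tightUI A B : tight A -> tight B -> tight (A :|: B) /\ tight (A :&: B).
Proof.
move=> /andP[uA /eqP mA] /andP[uB /eqP mB].
have uU := upsetU uA uB; have uI := upsetI uA uB.
have := massUI A B; rewrite mA mB.
have := feasible_upset fc uU; have := feasible_upset fc uI.
by rewrite /tight uU uI /=; split; apply/eqP; lia.
Qed.

Lemma tightU A B : tight A -> tight B -> tight (A :|: B).
Proof. by move=> tA tB; case: (tightUI tA tB). Qed.

Lemma tightI A B : tight A -> tight B -> tight (A :&: B).
Proof. by move=> tA tB; case: (tightUI tA tB). Qed.

(** Two points have the same hull exactly when no tight upset separates them. *)
Definition hull x := \bigcap_(A | tight A && (x \in A)) A.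

Lemma hull_tight x : tight (hull x).
Proof.
apply: (big_ind tight) => [|A B|A /andP[]//].
- by rewrite /tight upsetT feasible_total.
- exact: tightI.
Qed.

Lemma mem_hull x : x \in hull x.
Proof. by apply/bigcapP => A /andP[]. Qed.

Lemma hull_min x A : tight A -> x \in A -> hull x \subset A.
Proof. by move=> tA xA; apply: bigcap_inf; rewrite tA. Qed.

Lemma hull_upset x : upset (hull x).
Proof. by case/andP: (hull_tight x). Qed.

Lemma hull_sub x y : y \in hull x -> hull y \subset hull x.
Proof. exact/hull_min/hull_tight. Qed.

Lemma hull_le x y : cube_le x y -> y \in hull x.
Proof. by move=> xy; have /upsetP := hull_upset x; apply; [apply: mem_hull|]. Qed.

Lemma mass_partition_hull (P : pred (cube n)) :
  mass [set x | P x] = \sum_(S : {set cube n}) mass [set x | P x & hull x == S].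
Proof.
rewrite /mass (partition_big hull xpredT) //=; apply: eq_bigr => S _.
by apply: eq_bigl => x; rewrite !inE.
Qed.

(** Take the class X of cut points with a common hull S. A point y of S below some z in X also has
    hull S, and y outside X would force [flip i z] into S. So S minus X is an upset, of mass at most
    0, while S has mass 0. *)
Lemma mass_upper_cut i : 0 <= mass [set v : cube n | v i && (flip i v \notin hull v)].
Proof.
rewrite mass_partition_hull; apply: sumr_ge0 => S _.
set X := [set x | _ & _].
have [->|[x0]] := set_0Vmem X; first by rewrite mass0.
rewrite inE => /andP[_ /eqP hx0].
have /andP[uS /eqP mS] := hull_tight x0; rewrite hx0 in uS mS.
have XS : X \subset S.
  by apply/subsetP => x; rewrite inE => /andP[_ /eqP <-]; apply: mem_hull.
have /upsetP uS' := uS.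
have uD : upset (S :\: X).
  apply/upsetP => y z /setDP[yS yX] yz; rewrite inE (uS' y z) // andbT.
  apply: contra yX; rewrite !inE => /andP[/andP[zi zf] /eqP hz].
  rewrite hz in zf.
  have hy : hull y = S.
    apply/eqP; rewrite eqEsubset -{2}hz (hull_sub (hull_le yz)) andbT.
    by apply: hull_min => //; rewrite /tight uS mS eqxx.
  rewrite hy eqxx andbT; case: (boolP (y i)) => [yi|yi] /=; last first.
    by move: zf; rewrite (uS' y) // cube_le_flip_lower.
  apply: contra zf => yf; apply: (uS' _ _ yf); apply: cube_le_flip2 => //.
  by rewrite yi zi.
have := feasible_upset fc uD.
have /mass_disjointU : [disjoint X & S :\: X].
  by apply/pred0P => y /=; rewrite in_setD; case: (y \in X).
have -> : X :|: S :\: X = S by rewrite -{2}(setID S X) (setIidPr XS).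
by rewrite mS; lia.
Qed.

(** Dually, the points of S whose hull is smaller than S form a tight upset S', and adding the cut
    class Y of hull S to it leaves an upset. As S' has mass 0, Y has mass at most 0. *)
Lemma mass_lower_cut i :
  mass [set u : cube n | ~~ u i && (u \notin hull (flip i u))] <= 0.
Proof.
rewrite mass_partition_hull; apply: sumr_le0 => S _.
set Y := [set x | _ & _].
have [->|[x0]] := set_0Vmem Y; first by rewrite mass0.
rewrite inE => /andP[_ /eqP hx0].
have tS := hull_tight x0; rewrite hx0 in tS.
have /andP[/upsetP uS /eqP mS] := tS.
pose S' := \bigcup_(y in S | hull y != S) hull y.
have tS' : tight S'.
  apply: (big_ind tight) => [|A B|y _]; last exact: hull_tight.
  - by rewrite /tight upset0 mass0 eqxx.
  - exact: tightU.
have S'E y : (y \in S') = (y \in S) && (hull y != S).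
  apply/bigcupP/idP => [[z /andP[zS hz] yz]|h]; last first.
    by exists y => //; apply: mem_hull.
  have zS' : hull z \subset S by apply: hull_min.
  rewrite (subsetP zS') //=; apply: contra hz => /eqP hy.
  by rewrite eqEsubset zS' -hy hull_sub.
have /andP[/upsetP uS' /eqP mS'] := tS'.
have uY : upset (S' :|: Y).
  apply/upsetP => y z /setUP[yS' yz|].
    by rewrite inE (uS' y z).
  rewrite inE => /andP[/andP[yi yf] /eqP hy] yz; rewrite inE S'E.
  have yS : y \in S by rewrite -hy mem_hull.
  rewrite (uS y z) //=; case: eqP => //= hz; rewrite inE hz eqxx andbT.
  have yz' : y \in hull z by rewrite hz.
  have zi : ~~ z i.
    apply: contra yf => zi.
    have := hull_le (cube_le_flip_upper yi zi yz).
    by move=> /hull_sub/subsetP; apply.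
  rewrite zi /=; apply: contra yf => zf.
  have : flip i z \in hull (flip i y).
    by apply/hull_le/cube_le_flip2 => //; rewrite (negbTE yi) (negbTE zi).
  by move=> /hull_sub/subsetP/(_ _ zf) /hull_sub/subsetP; apply.
have := feasible_upset fc uY; rewrite mass_disjointU ?mS' ?add0r //.
rewrite -setI_eq0; apply/eqP/setP => y; rewrite !inE S'E.
by case: eqP => //; rewrite !andbF.
Qed.

Lemma mass_upperE i (P : pred (cube n)) :
  mass [set v : cube n | v i && P v] =
  \sum_(u : cube n | ~~ u i && P (flip i u)) c (flip i u).
Proof.
rewrite /mass (reindex_inj (can_inj (flipK i))) /=; apply: eq_bigl => u.
by rewrite inE flip_diag.
Qed.

Lemma mass_wt : \sum_x c x * (wt x)%:Z = \sum_i mass [set x : cube n | x i].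
Proof.
under [RHS]eq_bigr => i _ do rewrite massE.
rewrite exchange_big /=; apply: eq_bigr => x _.
by rewrite Posz_sum mulr_sumr; apply: eq_bigr => i _; rewrite inE.
Qed.

(** Slicing by layers, the weighted sum is the sum of the masses of the [W j]. Going strictly up
    from layer j lands in [W j], so [W j :|: P j] is an upset and [P j] has at most [- mass (W j)]
    points. *)
Lemma card_positive_le_wt :
  #|[set x | c x == 1]|%:Z <= - \sum_x c x * (wt x)%:Z.
Proof.
pose W j := [set x : cube n | (j < wt x)%N].
pose P j := [set x : cube n | (wt x == j) && (c x == 1)].
have uWP j : upset (W j :|: P j).
  apply/upsetP => x y; rewrite !inE => xj xy.
  have [<-|/(wt_lt xy) lxy] := eqVneq x y; first by [].
  by case/orP: xj => [?|/andP[/eqP <- _]];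
    [rewrite (leq_trans _ (ltnW lxy)) | rewrite lxy].
have massP j : mass (P j) = #|P j|%:Z.
  rewrite massE Posz_card; apply: eq_bigr => x _; rewrite inE.
  by case: (c x =P 1) => [->|_]; rewrite ?andbT ?andbF ?mul1r ?mulr0.
have le j : mass (W j) + #|P j|%:Z <= 0.
  rewrite -massP -mass_disjointU ?(feasible_upset fc) //.
  apply/pred0P => x /=; rewrite !inE; case: eqP => [->|]; first by rewrite ltnn.
  by rewrite andbF.
have -> : \sum_x c x * (wt x)%:Z = \sum_(j < n.+1) mass (W j).
  under [RHS]eq_bigr => j _ do rewrite massE.
  rewrite exchange_big /=; apply: eq_bigr => x _.
  rewrite -mulr_sumr; congr (_ * _).
  under eq_bigr => j _ do rewrite inE.
  rewrite -Posz_sum; congr Posz; rewrite -[LHS]card_ord -sum1_card.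
  have wx : (wt x <= n.+1)%N by apply: leq_trans (wt_max x) _.
  rewrite (big_ord_widen n.+1 (fun=> 1%N) wx) big_mkcond /=.
  by apply: eq_bigr => j _; case: ltnP.
have -> : #|[set x | c x == 1]|%:Z = \sum_(j < n.+1) #|P j|%:Z.
  have wtx x : (wt x < n.+1)%N by rewrite ltnS wt_max.
  rewrite -sum1_card (partition_big (fun x => Ordinal (wtx x)) xpredT) //=.
  rewrite Posz_sum; apply: eq_bigr => j _; rewrite -sum1_card; congr Posz.
  apply: eq_bigl => x.
  by rewrite !inE andbC -val_eqE.
rewrite -sumrN; apply: ler_sum => j _; have := le j; lia.
Qed.

End Charge.

(** * Charges of maximal value against an integer ranking *)

Section Optimal.
Variables (F : cube n -> int) (c : cube n -> int).
Hypothesis fc : feasible c.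
Hypothesis optc : forall c', feasible c' -> \sum_x c' x * F x <= \sum_x c x * F x.

(** Moving a unit of charge from b to a changes the value by [F a - F b]. Masses are integers, so an
    upset that gains the unit goes from negative to at most 0 and the new charge is feasible. *)
Lemma optimal_exchange a b :
  a != b -> c a <= 0 -> 0 <= c b ->
  (forall A, upset A -> a \in A -> b \notin A -> mass c A < 0) -> F a <= F b.
Proof.
move=> ab ca cb slack.
pose c' x := c x + ((x == a)%:Z - (x == b)%:Z).
have dsum (G : cube n -> int) : \sum_x c' x * G x = \sum_x c x * G x + (G a - G b).
  rewrite /c'; under eq_bigr => x _ do rewrite mulrDl mulrBl.
  have pick b0 : \sum_x (x == b0)%:Z * G x = G b0.
    rewrite (bigD1 b0) //= eqxx mul1r big1 ?addr0 // => x /negbTE ->.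
    by rewrite mul0r.
  by rewrite big_split sumrB /= !pick.
have massE A : mass c' A = mass c A + ((a \in A)%:Z - (b \in A)%:Z).
  by rewrite !massE dsum.
suff /optc : feasible c' by rewrite dsum; lia.
split=> [x|A uA|].
- have := feasible_bound fc x; rewrite /c'.
  have [xa|_] := eqVneq x a; have [xb|_] := eqVneq x b; subst; lia.
- rewrite massE; have := feasible_upset fc uA; have := slack A uA.
  by case: (a \in A) (b \in A) => [] [] //=; try lia; move=> /(_ isT isT); lia.
- by rewrite massE (feasible_total fc) !inE subrr.
Qed.

Lemma optimal_zero a b : cube_le a b -> c a = 0 -> c b = 0 -> F a <= F b.
Proof.
move=> ab ca cb; have [->//|nab] := eqVneq a b.
apply: optimal_exchange; rewrite ?ca ?cb // => A /upsetP uA aA /negP[].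
exact: uA ab.
Qed.

(** Otherwise no upset containing [flip i u] but not [u] is tight, and moving a unit of charge up
    the edge would increase the value. *)
Lemma optimal_edge i u : F u < F (flip i u) -> 0 <= c u -> c (flip i u) <= 0 ->
  u \notin hull c (flip i u).
Proof.
move=> Fu cu cv; apply/negP => uh; move: Fu; rewrite ltNge => /negP[].
apply: optimal_exchange => // [|A uA vA uA']; first exact: flip_neq.
rewrite lt_neqAle (feasible_upset fc) // andbT.
apply: contra uA' => mA; apply: (subsetP (hull_min _ vA)) uh.
by rewrite /tight uA.
Qed.

(** As c has total 0, the sum of [c u - c (flip i u)] over the edges of direction i is twice the
    left-hand side. Cut edges contribute at most 0 in total, by the two cut lemmas; each uncut edge
    contributes at most 2 if violating and at most 0 otherwise. *)
Lemma crossing_le_violations i :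
  - mass c [set x : cube n | x i] <=
  #|[set u : cube n | ~~ u i && (F (flip i u) <= F u)]|%:Z.
Proof.
pose cut u := u \notin hull c (flip i u).
have total : mass c [set u : cube n | ~~ u i] + mass c [set v : cube n | v i] = 0.
  rewrite -mass_disjointU.
    by rewrite -[RHS](feasible_total fc); congr mass; apply/setP => x; rewrite !inE orNb.
  by apply/pred0P => x /=; rewrite !inE andNb.
have lowE (P : pred (cube n)) : mass c [set u : cube n | ~~ u i && P u] =
    \sum_(u : cube n | ~~ u i && P u) c u.
  by apply: eq_bigl => u; rewrite inE.
have diff (P : pred (cube n)) :
    \sum_(u : cube n | ~~ u i && P u) (c u - c (flip i u)) =
    mass c [set u : cube n | ~~ u i && P u] -
    mass c [set v : cube n | v i && P (flip i v)].
  rewrite sumrB lowE mass_upperE; congr (_ - _).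
  by apply: eq_bigl => u; rewrite flipK.
have all : \sum_(u : cube n | ~~ u i) (c u - c (flip i u)) =
    - (2 * mass c [set v : cube n | v i]).
  have := diff predT; under eq_bigl do rewrite andbT.
  move=> ->; rewrite (_ : [set u | _ & _] = [set u : cube n | ~~ u i]); last first.
    by apply/setP => u; rewrite !inE andbT.
  rewrite (_ : [set v : cube n | v i & _] = [set v : cube n | v i]); last first.
    by apply/setP => u; rewrite !inE andbT.
  move: total; lia.
have cutle : \sum_(u : cube n | ~~ u i && cut u) (c u - c (flip i u)) <= 0.
  rewrite diff; have := mass_lower_cut fc i.
  have := mass_upper_cut fc i.
  rewrite (_ : [set v : cube n | v i & cut _] =
               [set v : cube n | v i && (flip i v \notin hull c v)]); last first.
    by apply/setP => v; rewrite !inE /cut flipK.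
  by move=> h1 h2; rewrite subr_le0; exact: le_trans h2 h1.
have uncut : \sum_(u : cube n | ~~ u i && ~~ cut u) (c u - c (flip i u)) <=
    2 * #|[set u : cube n | ~~ u i && (F (flip i u) <= F u)]|%:Z.
  have -> : #|[set u : cube n | ~~ u i && (F (flip i u) <= F u)]|%:Z =
      \sum_(u : cube n | ~~ u i) ((F (flip i u) <= F u)%R : nat)%:Z.
    rewrite Posz_card [RHS]big_mkcond /=; apply: eq_bigr => u _.
    by case: (u i).
  rewrite big_mkcondr mulr_sumr; apply: ler_sum => u ui.
  have := feasible_bound fc u; have := feasible_bound fc (flip i u).
  case: (leP (F (flip i u)) (F u)) => Fu; first by case: (cut u) => /=; lia.
  (* On an uncut edge where F increases, [c u < 0] or [c (flip i u) > 0]; with values in -1, 0, 1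
     the difference is at most 0. *)
  have := optimal_edge Fu; rewrite -/(cut u).
  case: (cut u) => //=; case: (leP 0 (c u)) => cu; last by lia.
  by case: (leP (c (flip i u)) 0) => cv; [move=> /(_ isT isT) | lia].
have := lerD cutle uncut; rewrite -bigID all add0r; lia.
Qed.

Lemma card_support_le :
  (#|[set x | c x != 0]| <=
   2 * \sum_i #|[set u : cube n | ~~ u i && (F (flip i u) <= F u)%R]|)%N.
Proof.
(* Total 0 gives as many points of charge -1 as of charge 1. *)
have -> : (#|[set x | c x != 0%R]| = 2 * #|[set x | c x == 1%R]|)%N.
  apply/eqP; rewrite -eqz_nat PoszM !Posz_card mulr_sumr -subr_eq0 -sumrB.
  have := feasible_total fc; rewrite /mass => tot.
  rewrite -oppr_eq0 -sumrN -[X in _ == X]tot; apply/eqP.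
  rewrite [RHS]big_mkcond; apply: eq_bigr => x _; rewrite inE.
  have := feasible_bound fc x.
  by have [e|e] := eqVneq (c x) 1; have [e0|e0] := eqVneq (c x) 0; rewrite ?inE; lia.
rewrite leq_mul2l /= -lez_nat.
apply: le_trans (card_positive_le_wt fc) _.
rewrite mass_wt -sumrN Posz_sum.
by apply: ler_sum => i _; apply: crossing_le_violations.
Qed.

End Optimal.

(** Coding the three values of a charge in ['I_3], shifted by 1, makes the feasible set finite; it
    contains the zero charge. *)
Lemma exists_optimal (F : cube n -> int) :
  exists2 c, feasible c &
    forall c', feasible c' -> \sum_x c' x * F x <= \sum_x c x * F x.
Proof.
pose val (c : {ffun cube n -> 'I_3}) x : int := (c x)%:Z - 1.
pose feasb c := [forall A, upset A ==> (mass (val c) A <= 0)] && (mass (val c) setT == 0).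
have feasP c : reflect (feasible (val c)) (feasb c).
  apply: (iffP andP) => [[/forallP up /eqP tot]|[_ up tot]].
    split=> // [x|A]; last by move/implyP: (up A).
    by rewrite /val; case: (c x) => m /=; lia.
  by split; [apply/forallP => A; apply/implyP; apply: up | apply/eqP].
pose c0 : {ffun cube n -> 'I_3} := [ffun=> inord 1].
have c0E x : val c0 x = 0 by rewrite /val ffunE inordK.
have fc0 : feasb c0.
  apply/feasP; split=> [x|A _|]; rewrite ?c0E //.
    by rewrite /mass big1.
  by rewrite /mass big1.
have [c /feasP fc opt] := Order.TotalTheory.arg_maxP (fun c => \sum_x val c x * F x) fc0.
exists (val c) => // c' fc'.
pose k : {ffun cube n -> 'I_3} := [ffun x => inord (absz (c' x + 1))].
have kE x : val k x = c' x.
  rewrite /val ffunE inordK; have := feasible_bound fc' x; lia.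
have fk : feasb k.
  have mk A : mass (val k) A = mass c' A by apply: eq_bigr => x _; rewrite kE.
  apply/andP; split; last by rewrite mk (feasible_total fc').
  by apply/forallP => A; apply/implyP => uA; rewrite mk (feasible_upset fc').
rewrite (eq_bigr (fun x => val k x * F x)); first exact: opt k fk.
by move=> x _; rewrite kE.
Qed.

End CubeOrder.

Lemma monotone_off_violations (d : Order.disp_t) (R : orderType d) (n : nat)
    (f : cube n -> R) :
  exists2 Z : {set cube n},
    {in Z &, forall x y, cube_le x y -> (f x <= f y)%O} &
    (#|~: Z| <= 2 * \sum_i #|[set u : cube n | ~~ u i && (f (flip i u) < f u)%O]|)%N.
Proof.
pose r x := #|[set z | (f z < f x)%O]|.
(* Weights are at most n, so the rank [r] dominates and the weight only breaks ties, upwards: an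
   edge violates F only where f strictly decreases. *)
pose F x : int := (n.+1 * r x + wt x)%N%:Z.
have r_le x y : (f x <= f y)%O -> (r x <= r y)%N.
  move=> xy; apply/subset_leq_card/subsetP => z; rewrite !inE => /lt_le_trans; exact.
have r_lt x y : (f x < f y)%O -> (r x < r y)%N.
  move=> xy; apply/proper_card/properP; split.
    by apply/subsetP => z; rewrite !inE => /lt_trans; apply.
  by exists x; rewrite !inE ?ltxx.
have [c fc opt] := exists_optimal F.
exists [set x | c x == 0] => [x y|].
  rewrite !inE => /eqP cx /eqP cy xy; rewrite leNgt; apply/negP => /r_lt.
  have := optimal_zero fc opt xy cx cy; rewrite /F lez_nat.
  have := wt_max x; have := wt_max y; nia.
rewrite (_ : ~: _ = [set x | c x != 0]); last by apply/setP => x; rewrite !inE.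
apply: leq_trans (card_support_le fc opt) _.
rewrite leq_mul2l /=; apply: leq_sum => i _; apply/subset_leq_card/subsetP => u.
rewrite !inE => /andP[ui]; rewrite ui /= /F lez_nat => le.
rewrite ltNge; apply/negP => /r_le.
have := wt_lt (cube_le_flip ui); rewrite eq_sym flip_neq => /(_ isT).
move: le; nia.
Qed.

(** * Distance to unateness *)

Section UnateDistance.
Context {d : Order.disp_t} {R : orderType d} {n : nat}.
Implicit Types (f g : cube n -> R) (i : 'I_n) (x y z u : cube n).

Lemma monotone_extension f (Z : {set cube n}) :
  {in Z &, forall x y, cube_le x y -> (f x <= f y)%O} ->
  exists2 g, (forall x y, cube_le x y -> (g x <= g y)%O) &
             {in Z, forall x, g x = f x}.
Proof.
move=> fZ.
(* The least value of f serves as the default of the maximum, so it never exceeds [f x]. *)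
have [x0 _ fx0] := Order.TotalTheory.arg_minP f (isT : predT [ffun=> false]).
pose g x := \big[Order.max/f x0]_(z in Z | cube_le z x) f z.
exists g => [x y xy|x xZ].
  apply: bigmax_le => [|z /andP[zZ zx]]; first exact: bigmax_ge_id.
  by apply: le_bigmax_cond; rewrite zZ (cube_le_trans zx).
apply/eqP; rewrite eq_le; apply/andP; split.
  by apply: bigmax_le => [|z /andP[zZ zx]]; [exact: fx0 | exact: fZ].
by apply: le_bigmax_cond; rewrite xZ cube_le_refl.
Qed.

(** An edge is represented by its lower endpoint, hence counted once. *)
Definition increasing_edges f i := [set u : cube n | ~~ u i && (f u < f (flip i u))%O].
Definition decreasing_edges f i := [set u : cube n | ~~ u i && (f (flip i u) < f u)%O].

Definition reorient (b x : cube n) : cube n := [ffun j => x j (+) b j].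

Lemma reorientK b : involutive (reorient b).
Proof. by move=> x; apply/ffunP => j; rewrite !ffunE -addbA addbb addbF. Qed.

Lemma reorient_flip b i x : reorient b (flip i x) = flip i (reorient b x).
Proof. by apply/ffunP => j; rewrite !ffunE -!addbA (addbC (b j)). Qed.

Lemma exists_unate_close f : exists2 g, unate g &
  (#|[pred x | f x != g x]| <=
   2 * \sum_i minn #|increasing_edges f i| #|decreasing_edges f i|)%N.
Proof.
(* Flipping the directions with no more increasing than decreasing edges makes the decreasing edges
   of [f'] the less frequent kind in every direction. *)
pose b : cube n :=
  [ffun i => (#|increasing_edges f i| <= #|decreasing_edges f i|)%N].
pose f' x := f (reorient b x).
have [Z fZ cardZ] := monotone_off_violations f'.
have [g' g'mono g'Z] := monotone_extension fZ.
have mono_lo i x : ~~ x i -> (g' x <= g' (flip i x))%O.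
  by move=> xi; apply/g'mono/cube_le_flip.
have mono_hi i x : x i -> (g' (flip i x) <= g' x)%O.
  by move=> xi; rewrite -{2}(flipK i x) mono_lo // flip_diag xi.
exists (fun x => g' (reorient b x)).
  move=> i; case: (boolP (b i)) => bi; [right | left] => x;
    rewrite /deriv_le0 /deriv_ge0 reorient_flip; case: ifP => xi;
    by [apply: mono_lo; rewrite ffunE xi bi | apply: mono_hi; rewrite ffunE xi bi
       |apply: mono_lo; rewrite ffunE xi (negbTE bi)
       |apply: mono_hi; rewrite ffunE xi (negbTE bi)].
have -> : #|[pred x | f x != g' (reorient b x)]| = #|[set x | f' x != g' x]|.
  rewrite -[RHS](card_preimset _ (can_inj (reorientK b))).
  by apply: eq_card => x; rewrite !inE /f' reorientK.
have sub : (#|[set x | f' x != g' x]| <= #|~: Z|)%N.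
  apply/subset_leq_card/subsetP => x; rewrite !inE.
  by apply: contraNN => /g'Z ->.
apply: leq_trans (leq_trans sub cardZ) _.
rewrite leq_mul2l /=; apply: leq_sum => i _.
case: (boolP (b i)) => bi.
  have /minn_idPl -> : (#|increasing_edges f i| <= #|decreasing_edges f i|)%N.
    by move: bi; rewrite ffunE.
  (* Here [reorient b] exchanges lower and upper endpoints; [flip i] returns to the lower one. *)
  have inj : injective (fun x => flip i (reorient b x)).
    exact: inj_comp (can_inj (flipK i)) (can_inj (reorientK b)).
  rewrite -(card_preimset _ inj); apply/subset_leq_card/subsetP => x.
  by rewrite !inE flip_diag flipK ffunE bi addbT negbK /f' reorient_flip.
have /minn_idPr -> : (#|decreasing_edges f i| <= #|increasing_edges f i|)%N.
  by move: bi; rewrite ffunE -ltnNge => /ltnW.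
rewrite -(card_preimset _ (can_inj (reorientK b))); apply/subset_leq_card/subsetP => x.
by rewrite !inE ffunE (negbTE bi) addbF /f' reorient_flip.
Qed.

Lemma unate_edges f i u w : unate f ->
  u \in increasing_edges f i -> w \in decreasing_edges f i -> False.
Proof.
move=> uf; rewrite !inE => /andP[ui fu] /andP[wi fw].
case: (uf i) => [/(_ w) | /(_ u)]; rewrite /deriv_ge0 /deriv_le0.
  by rewrite (negbTE wi) leNgt fw.
by rewrite (negbTE ui) leNgt fu.
Qed.

Lemma unate_far_edges {K : realType} (eps : K) f : unate_far eps f ->
  eps / 2 <= \sum_i (minn #|increasing_edges f i| #|decreasing_edges f i|)%:R /
                    #|{: cube n}|%:R.
Proof.
move=> far; have [g ug close] := exists_unate_close f.
have cube_gt0 : 0 < #|{: cube n}|%:R :> K.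
  by rewrite ltr0n; apply/card_gt0P; exists [ffun=> false].
have : eps <= hdist (K := K) f g.
  apply: le_trans far _; apply: ge_inf; last by exists g.
  by exists 0 => _ [h _ <-]; rewrite divr_ge0.
rewrite /hdist -mulr_suml ler_pdivlMr // ler_pdivlMr // => epsle.
have : #|[pred x | f x != g x]|%:R <= 2 * \sum_i
   (minn #|increasing_edges f i| #|decreasing_edges f i|)%:R :> K.
  by rewrite -natr_sum -natrM ler_nat.
move: epsle; lra.
Qed.

End UnateDistance.

(** * The tester and its execution *)

(** Both endpoints are queried before any comparison and whatever the bit, which keeps the tester
    non-adaptive; points with coordinate 1 are discarded only afterwards. *)
Definition sample_body : seq cmd :=
  [:: RandPt 0; Flip 1 0 0; Query 0 0; Query 1 1; Bit 9 0 0;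
      IfNum 3 9 [::] [:: IfAns 1 0 [::] [:: Const 7 1];
                         IfAns 0 1 [::] [:: Const 8 1]];
      Add 6 6 3].

(** The loop counter 5 grows by [eps * 2 ^+ t], kept in register 1, up to 128 n: this yields the
    number of trials without a division. *)
Definition trial_body : seq cmd :=
  [:: RandDir 0; Const 6 0; Const 7 0; Const 8 0;
      While 6 4 sample_body;
      IfNum 3 7 [:: IfNum 3 8 [:: Const 0 0] [::]] [::];
      Add 5 5 1].

Definition level_body : seq cmd :=
  [:: Const 5 0; While 5 2 trial_body; Add 1 1 1; Add 4 4 4].

(* Registers: 0 verdict, 1 eps * 2^t, 2 bound 128 n, 3 the constant 1,
   4 samples per trial 2^t, 5 and 6 loop counters, 7 and 8 whether an
   increasing, resp. decreasing, edge was seen, 9 scratch. *)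
Definition tester : seq cmd :=
  [:: Add 2 0 0; Add 2 2 2; Add 2 2 2; Add 2 2 2; Add 2 2 2; Add 2 2 2; Add 2 2 2;
      Const 0 1; Const 3 1; Const 4 1;
      While 1 2 level_body].

(** * The random tape read as a list of trials *)

Section Schedule.
Context {d : Order.disp_t} {R : orderType d} {n : nat}.
Variable f : cube n -> R.
Implicit Types (w : seq (coin n)) (k : nat) (ks : seq nat).

Definition sees (E : {set cube n}) w := has (fun z : coin n => z.1 \in E) w.

(** The first cell supplies the direction, the next k cells the points. *)
Definition trial_ok k w : bool :=
  if w is z :: w' then
    ~~ (sees (increasing_edges f z.2) (take k w') &&
        sees (decreasing_edges f z.2) (take k w'))
  else true.

(** A function of the tape alone and not of f: this is the source of non-adaptivity. *)
Definition sample_queries (i : 'I_n) w : seq (cube n) :=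
  flatten [seq [:: z.1; flip i z.1] | z <- w].

Definition trial_queries k w : seq (cube n) :=
  if w is z :: w' then sample_queries z.2 (take k w') else [::].

Fixpoint all_ok ks w : bool :=
  if ks is k :: ks' then trial_ok k w && all_ok ks' (drop k.+1 w) else true.

Fixpoint all_queries ks w : seq (cube n) :=
  if ks is k :: ks' then trial_queries k w ++ all_queries ks' (drop k.+1 w)
  else [::].

Definition cells ks := \sum_(k <- ks) k.+1.

Lemma cells_cat ks ks' : cells (ks ++ ks') = (cells ks + cells ks')%N.
Proof. exact: big_cat. Qed.

Lemma cells_cons k ks : cells (k :: ks) = (k.+1 + cells ks)%N.
Proof. exact: big_cons. Qed.

Lemma all_ok_cat ks ks' w :
  all_ok (ks ++ ks') w = all_ok ks w && all_ok ks' (drop (cells ks) w).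
Proof.
elim: ks w => [|k ks IH] w /=; first by rewrite /cells big_nil drop0.
by rewrite IH andbA drop_drop cells_cons addnC.
Qed.

Lemma all_queries_cat ks ks' w :
  all_queries (ks ++ ks') w = all_queries ks w ++ all_queries ks' (drop (cells ks) w).
Proof.
elim: ks w => [|k ks IH] w /=; first by rewrite /cells big_nil drop0.
by rewrite IH catA drop_drop cells_cons addnC.
Qed.

Lemma trial_ok_take k m w : (k < m)%N -> trial_ok k (take m w) = trial_ok k w.
Proof. by case: m w => // m [|z w] km //=; rewrite take_takel. Qed.

Lemma trial_queries_take k m w : (k < m)%N ->
  trial_queries k (take m w) = trial_queries k w.
Proof. by case: m w => // m [|z w] km //=; rewrite take_takel. Qed.

Lemma all_ok_take ks w : all_ok ks (take (cells ks) w) = all_ok ks w.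
Proof.
elim: ks w => //= k ks IH w; rewrite cells_cons trial_ok_take ?ltn_addr // addnC.
by rewrite -take_drop IH.
Qed.

Lemma all_queries_take ks w :
  all_queries ks (take (cells ks) w) = all_queries ks w.
Proof.
elim: ks w => //= k ks IH w; rewrite cells_cons trial_queries_take ?ltn_addr // addnC.
by rewrite -take_drop IH.
Qed.

End Schedule.

(** * Step-counted execution of the program *)

Section Execution.
Context {K : realType} {d : Order.disp_t} {R : orderType d} {n : nat}.
Variable f : cube n -> R.
Local Notation state := (@state K d R n).
Implicit Types (s : state) (Q : state -> Prop) (w : seq (coin n)) (c : seq cmd).

(** Only an upper bound on the step count is recorded, so that branches of different lengths share
    one bound. *)
Variant exec s (k : nat) Q : Prop :=
  Exec j of (j <= k)%N & Q (iter j (step f) s).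

Lemma exec_step s k Q : exec (step f s) k Q -> exec s k.+1 Q.
Proof. by case=> j jk h; apply: (@Exec _ _ _ j.+1); rewrite // iterSr. Qed.

Lemma exec_done s k Q : Q s -> exec s k Q.
Proof. exact: (@Exec _ _ _ 0). Qed.

Lemma exec_bind s k l Q Q' : exec s k Q -> (forall s', Q s' -> exec s' l Q') ->
  exec s (k + l) Q'.
Proof.
case=> j jk h /(_ _ h) [j' jl h']; apply: (@Exec _ _ _ (j' + j)); last by rewrite iterD.
by rewrite addnC leq_add.
Qed.

Definition at_point s c w q := [/\ code s = c, tape s = w & asked s = q].

Definition frame (lo hi : nat) s s' :=
  forall r, (lo <= r < hi)%N -> num s' r = num s r.

(** The 12 steps are the guard, five straight-line instructions, the test of the bit, two
    comparisons each followed by an assignment, and the increment. *)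
Lemma exec_sample (i : 'I_n) z s (j k : nat) (a b : bool) c w q :
  at_point s (While 6 4 sample_body :: c) (z :: w) q ->
  dir s 0 = Some i -> num s 3 = 1 -> num s 4 = k%:R -> num s 6 = j%:R ->
  num s 7 = a%:R -> num s 8 = b%:R -> (j < k)%N ->
  exec s 12 (fun s' =>
    [/\ at_point s' (While 6 4 sample_body :: c) w (q ++ [:: z.1; flip i z.1]),
        frame 0 6 s s', dir s' 0 = Some i, num s' 6 = j.+1%:R &
        num s' 7 = (a || (z.1 \in increasing_edges f i))%:R /\
        num s' 8 = (b || (z.1 \in decreasing_edges f i))%:R]).
Proof.
case: s => c0 w0 q0 nm dr px an [/= -> -> ->] hd h3 h4 h6 h7 h8 jk.
apply: exec_step; rewrite /= h6 h4 ltr_nat jk /=.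
do 5!(apply: exec_step; rewrite /= ?hd /=).
rewrite !inE -cats1 -cats1 -catA /=.
apply: exec_step; rewrite /= h3; case zi: (z.1 i).
  rewrite lexx /=; apply: exec_step => /=; apply: exec_done; split=> //=.
  - by case=> [|[|[|[|[|[|[]]]]]]].
  - by rewrite h6 h3 -natr1.
  - by rewrite !orbF.
rewrite ler10 /=.
apply: exec_step => /=; rewrite -[ans_le _ _]/(_ <= _)%O !ltNge.
(case: (f (flip i z.1) <= f z.1)%O => /=; [idtac | apply: exec_step => /=]);
  (apply: exec_step; rewrite /= -[ans_le _ _]/(_ <= _)%O;
   case: (f z.1 <= f (flip i z.1))%O => /=; [idtac | apply: exec_step => /=]);
  apply: exec_step => /=; apply: exec_done;
  split=> //=; rewrite ?orbF ?orbT ?h6 ?h3 -?natr1 //;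
  by case=> [|[|[|[|[|[|[]]]]]]].
Qed.

Lemma exec_samples (i : 'I_n) ys : forall s (j k : nat) (a b : bool) c w q,
  at_point s (While 6 4 sample_body :: c) (ys ++ w) q ->
  dir s 0 = Some i -> num s 3 = 1 -> num s 4 = k%:R -> num s 6 = j%:R ->
  num s 7 = a%:R -> num s 8 = b%:R -> (j + size ys)%N = k ->
  exec s (12 * size ys).+1 (fun s' =>
    [/\ at_point s' c w (q ++ sample_queries i ys), frame 0 6 s s',
        num s' 7 = (a || sees (increasing_edges f i) ys)%:R
      & num s' 8 = (b || sees (decreasing_edges f i) ys)%:R]).
Proof.
elim: ys => [|z ys IH] s j k a b c w q.
  case: s => c0 w0 q0 nm dr px an [/= -> -> ->] hd h3 h4 h6 h7 h8.
  rewrite addn0 => jk; apply: exec_step; rewrite /= h6 h4 jk ltxx.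
  by apply: exec_done; split=> //=; rewrite ?cats0 ?orbF.
move=> at_s hd h3 h4 h6 h7 h8 jk; rewrite mulnS -addnS.
have jltk : (j < k)%N by rewrite -jk -addSnnS leq_addr.
apply: exec_bind (exec_sample at_s hd h3 h4 h6 h7 h8 jltk) _.
move=> s' [at_s' fr hd' h6' [h7' h8']].
have [h3' h4'] : num s' 3 = 1 /\ num s' 4 = k%:R by rewrite !fr.
have [] := IH s' _ k _ _ c w _ at_s' hd' h3' h4' h6' h7' h8'.
  by rewrite -jk addSnnS.
move=> l ll [at_s'' fr' h7'' h8'']; apply: Exec ll _.
by split; rewrite ?h7'' ?h8'' ?orbA // ?[_ ++ sample_queries i (z :: ys)]catA //
  => r hr; rewrite fr' ?fr.
Qed.

Lemma exec_trial (k : nat) (v : bool) acc e ys s c w q :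
  at_point s (trial_body ++ c) (ys ++ w) q -> size ys = k.+1 ->
  num s 0 = v%:R -> num s 1 = e -> num s 3 = 1 -> num s 4 = k%:R -> num s 5 = acc ->
  exec s (12 * k + 9) (fun s' =>
    [/\ at_point s' c w (q ++ trial_queries k ys), frame 1 5 s s',
        num s' 0 = (v && trial_ok f k ys)%:R & num s' 5 = acc + e]).
Proof.
case: ys => // z ys; case: s => c0 w0 q0 nm dr px an [/= -> -> ->] [<-].
move=> h0 h1 h3 h4 h5; rewrite take_size.
(* Four instructions before the inner loop, at most four after it, and the failing guard of that
   loop. *)
rewrite (_ : 12 * size ys + 9 = ((12 * size ys).+1 + 4).+4)%N; last by lia.
do 4!(apply: exec_step; rewrite /=).
set s1 := State _ _ _ _ _ _ _.
have := @exec_samples z.2 ys s1 0%N (size ys) false false _ w q.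
move=> /(_ _ (And3 erefl erefl erefl) erefl h3 h4 erefl erefl erefl).
move=> /(_ (add0n _)) ex.
apply: (exec_bind (l := 4) ex) => s2 [at_s2 fr h7 h8].
case: s2 at_s2 fr h7 h8 => c1 w1 q1 nm1 dr1 px1 an1 at_s2 fr h7 h8.
have [/= ? ? ?] := at_s2; subst c1 w1 q1; move: h7 h8 => /= h7 h8.
have g r : (r < 6)%N -> nm1 r = nm r.
  by move=> r6; rewrite [LHS]fr //=; case: r r6 => [|[|[|[|[|[|]]]]]].
move=> {fr}.
set A := sees _ ys in h7 *; set B := sees _ ys in h8 *.
apply: exec_step => /=; rewrite g // h3 h7.
case: A {h7} => /=; rewrite ?lexx ?ler10 /=.
  apply: exec_step => /=; rewrite g // h3 h8.
  case: B {h8} => /=; rewrite ?lexx ?ler10 /=.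
    apply: exec_step => /=; apply: exec_step => /=; apply: exec_done; split=> //=.
    - by move=> r /andP[r1 r5]; case: r r1 r5 => [|[|[|[|[|]]]]] //= _ _; rewrite g.
    - by rewrite andbF.
    - by rewrite !g // h1 h5.
  apply: exec_step => /=; apply: exec_done; split=> //=.
  - by move=> r /andP[r1 r5]; case: r r1 r5 => [|[|[|[|[|]]]]] //= _ _; rewrite g.
  - by rewrite andbT g.
  - by rewrite !g // h1 h5.
apply: exec_step => /=; apply: exec_done; split=> //=.
- by move=> r /andP[r1 r5]; case: r r1 r5 => [|[|[|[|[|]]]]] //= _ _; rewrite g.
- by rewrite andbT g.
- by rewrite !g // h1 h5.
Qed.

Fixpoint schedule_cost ks :=
  if ks is k :: ks' then (12 * k + 10 + schedule_cost ks')%N else 0%N.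

(** Register 5 holds [j%:R * e]; the last two hypotheses say that the guard succeeds exactly m more
    times. *)
Lemma exec_trials (k : nat) (B e : K) m : forall s (j : nat) (v : bool) c ys w q,
  at_point s (While 5 2 trial_body :: c) (ys ++ w) q ->
  size ys = cells (nseq m k) ->
  num s 0 = v%:R -> num s 1 = e -> num s 2 = B -> num s 3 = 1 ->
  num s 4 = k%:R -> num s 5 = j%:R * e ->
  (forall l, (l < j + m)%N -> l%:R * e < B) -> B <= (j + m)%:R * e ->
  exec s (schedule_cost (nseq m k)).+1 (fun s' =>
    [/\ at_point s' c w (q ++ all_queries (nseq m k) ys), frame 1 5 s s' &
        num s' 0 = (v && all_ok f (nseq m k) ys)%:R]).
Proof.
elim: m => [|m IH] s j v c ys w q.
  case: s => c0 w0 q0 nm dr px an [/= -> -> ->].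
  rewrite /cells big_nil => /size0nil -> h0 h1 h2 h3 h4 h5 _; rewrite addn0 => Bj.
  apply: exec_step; rewrite /= h5 h2 ltNge Bj /=.
  by apply: exec_done; split; rewrite ?cats0 ?andbT.
move=> at_s szys h0 h1 h2 h3 h4 h5 lt ge.
have szt : size (take k.+1 ys) = k.+1.
  by rewrite size_takel // szys /= cells_cons leq_addr.
have szd : size (drop k.+1 ys) = cells (nseq m k).
  by rewrite size_drop szys /= cells_cons addKn.
have ysE := cat_take_drop k.+1 ys.
rewrite (_ : (schedule_cost (nseq m.+1 k)).+1 =
  (12 * k + 9 + (schedule_cost (nseq m k)).+1).+1)%N; last by rewrite /=; lia.
have jB : j%:R * e < B by apply: lt; rewrite addnS leq_addr.
apply: exec_step.
have at_s' : at_point (step f s) (trial_body ++ While 5 2 trial_body :: c)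
    (take k.+1 ys ++ (drop k.+1 ys ++ w)) q.
  case: s at_s h2 h5 {h0 h1 h3 h4} => c0 w0 q0 nm dr px an [/= -> -> ->] h2 h5.
  by rewrite catA ysE; split; rewrite //= h5 h2 jB.
have num_s' r : num (step f s) r = num s r.
  by case: s at_s {at_s' h0 h1 h2 h3 h4 h5} => c0 w0 q0 nm dr px an [/= -> _ _].
have ex := exec_trial at_s' szt (etrans (num_s' 0%N) h0) (etrans (num_s' 1%N) h1)
  (etrans (num_s' 3%N) h3) (etrans (num_s' 4%N) h4) (etrans (num_s' 5%N) h5).
apply: (exec_bind ex) => s2 [at2 fr h02 h52].
have fr' r : (1 <= r < 5)%N -> num s2 r = num s r by move=> r5; rewrite fr.
have h52' : num s2 5 = j.+1%:R * e by rewrite h52 -natr1 mulrDl mul1r.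
have [] := IH s2 j.+1 _ c (drop k.+1 ys) w _ at2 szd h02
  (etrans (fr' 1%N isT) h1) (etrans (fr' 2%N isT) h2) (etrans (fr' 3%N isT) h3)
  (etrans (fr' 4%N isT) h4) h52'; rewrite ?addSnnS //.
move=> l ll [at3 fr3 h03]; apply: Exec ll _.
split.
- by move: at3; rewrite trial_queries_take // -catA.
- by move=> r r5; rewrite fr3 ?fr'.
- by rewrite h03 trial_ok_take // andbA.
Qed.

Lemma schedule_cost_cat ks ks' :
  schedule_cost (ks ++ ks') = (schedule_cost ks + schedule_cost ks')%N.
Proof. by elim: ks => //= k ks ->; rewrite addnA. Qed.

Lemma cells_le_cost ks : (cells ks <= schedule_cost ks)%N.
Proof.
elim: ks => [|k ks IH] /=; first by rewrite /cells big_nil.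
by rewrite cells_cons; lia.
Qed.

Section Levels.
Variables (B e0 : K) (rep : nat -> nat).
Hypothesis rep_lt : forall t l, (l < rep t)%N -> l%:R * (e0 * 2 ^+ t) < B.
Hypothesis rep_ge : forall t, B <= (rep t)%:R * (e0 * 2 ^+ t).

Definition levels t m := flatten [seq nseq (rep t') (2 ^ t')%N | t' <- iota t m].

Lemma exec_levels m : forall s t (v : bool) ys w q,
  at_point s [:: While 1 2 level_body] (ys ++ w) q ->
  size ys = cells (levels t m) ->
  num s 0 = v%:R -> num s 1 = e0 * 2 ^+ t -> num s 2 = B -> num s 3 = 1 ->
  num s 4 = (2 ^ t)%:R ->
  (forall l, (l < t + m)%N -> e0 * 2 ^+ l < B) -> B <= e0 * 2 ^+ (t + m) ->
  exec s (schedule_cost (levels t m) + 5 * m).+1 (fun s' =>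
    at_point s' [::] w (q ++ all_queries (levels t m) ys) /\
    num s' 0 = (v && all_ok f (levels t m) ys)%:R).
Proof.
elim: m => [|m IH] s t v ys w q.
  case: s => c0 w0 q0 nm dr px an [/= -> -> ->].
  rewrite /cells big_nil => /size0nil -> h0 h1 h2 h3 h4 _; rewrite addn0 => Bj.
  apply: exec_step; rewrite /= h1 h2 ltNge Bj /=.
  by apply: exec_done; split; rewrite ?cats0 ?andbT.
move=> at_s szys h0 h1 h2 h3 h4 lt ge.
pose ks := nseq (rep t) (2 ^ t)%N.
have lvE : levels t m.+1 = ks ++ levels t.+1 m by [].
have szt : size (take (cells ks) ys) = cells ks.
  by rewrite size_takel // szys lvE cells_cat leq_addr.
have szd : size (drop (cells ks) ys) = cells (levels t.+1 m).
  by rewrite size_drop szys lvE cells_cat addKn.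
have ysE := cat_take_drop (cells ks) ys.
rewrite lvE schedule_cost_cat.
rewrite (_ : (_ + _ + 5 * m.+1).+1 = ((schedule_cost ks).+1 +
  ((schedule_cost (levels t.+1 m) + 5 * m).+1.+2)).+2)%N; last by lia.
case: s at_s h0 h1 h2 h3 h4 => c0 w0 q0 nm dr px an [/= -> -> ->] h0 h1 h2 h3 h4.
have ltB : e0 * 2 ^+ t < B by apply: lt; rewrite addnS ltnS leq_addr.
apply: exec_step; rewrite /= h1 h2 ltB /=.
apply: exec_step => /=.
set s1 := State _ _ _ _ _ _ _.
have h51 : num s1 5 = 0%:R * (e0 * 2 ^+ t) by rewrite mul0r.
have at1 : at_point s1 (While 5 2 trial_body ::
    [:: Add 1 1 1; Add 4 4 4; While 1 2 level_body])
    (take (cells ks) ys ++ (drop (cells ks) ys ++ w)) q.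
  by rewrite catA ysE.
have ex := exec_trials at1 szt h0 h1 h2 h3 h4 h51 (@rep_lt t) (@rep_ge t).
apply: (exec_bind ex) => -[c2 w2 q2 nm2 dr2 px2 an2] [at2 fr h02].
have [/= ? ? ?] := at2; subst c2 w2 q2.
have fr' r : (1 <= r < 5)%N -> nm2 r = nm r.
  move=> /andP[r1 r5]; move: (fr r); rewrite r1 r5 /= => -> //.
  by case: r r1 r5 => [|[|[|[|[|]]]]].
do 2!(apply: exec_step; rewrite /=).
set s3 := State _ _ _ _ _ _ _.
have h13 : num s3 1 = e0 * 2 ^+ t.+1.
  by rewrite /= fr' // h1 exprS; ring.
have h43 : num s3 4 = (2 ^ t.+1)%:R.
  by rewrite /= fr' // h4 expnS mulSn mul1n natrD.
have h23 : num s3 2 = B by rewrite /= fr'.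
have h33 : num s3 3 = 1 by rewrite /= fr'.
have at3 : at_point s3 [:: While 1 2 level_body] (drop (cells ks) ys ++ w)
  (q ++ all_queries ks (take (cells ks) ys)) by [].
have [] := IH s3 t.+1 _ _ w _ at3 szd h02 h13 h23 h33 h43; rewrite ?addSnnS //.
move=> l ll [at4 h04]; apply: Exec ll _.
rewrite all_queries_cat all_ok_cat -(all_ok_take f _ ys) -(all_queries_take _ ys).
split.
  by move: at4; rewrite -catA.
by rewrite h04 andbA.
Qed.

End Levels.

End Execution.

(** * Rejection probability *)

Section Expectation.
Context {K : realFieldType} {C : finType}.
Hypothesis C_gt0 : (0 < #|C|)%N.
Implicit Types (phi psi : seq C -> K) (T : nat) (w : seq C).

Let C_neq0 : #|C|%:R != 0 :> K.
Proof. by rewrite pnatr_eq0 -lt0n. Qed.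

(** Averaging cell by cell makes a prefix and a suffix of the tape independent by construction;
    [sum_tuple_expect] relates this to uniform tuples. *)
Fixpoint expect T phi : K :=
  if T is T'.+1 then (\sum_(z : C) expect T' (fun w => phi (z :: w))) / #|C|%:R
  else phi [::].

Lemma expect_le T phi psi : (forall w, size w = T -> phi w <= psi w) ->
  expect T phi <= expect T psi.
Proof.
elim: T phi psi => [|T IH] phi psi le /=; first exact: le.
rewrite ler_wpM2r ?invr_ge0 //; apply: ler_sum => z _.
by apply: IH => w sw; apply: le; rewrite /= sw.
Qed.

Lemma eq_expect T phi psi : (forall w, size w = T -> phi w = psi w) ->
  expect T phi = expect T psi.
Proof.
by move=> eq; apply/eqP; rewrite eq_le !expect_le // => w /eq ->.
Qed.

Lemma expect_cst T (a : K) : expect T (fun=> a) = a.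
Proof.
elim: T => //= T ->.
by rewrite sumr_const -[_ *+ _]mulr_natr -mulrA divff ?mulr1.
Qed.

Lemma expectD T phi psi :
  expect T (fun w => phi w + psi w) = expect T phi + expect T psi.
Proof.
elim: T phi psi => //= T IH phi psi; rewrite -mulrDl -big_split /=.
by congr (_ / _); apply: eq_bigr => z _; rewrite IH.
Qed.

Lemma expectZ T (a : K) phi : expect T (fun w => a * phi w) = a * expect T phi.
Proof.
elim: T phi => //= T IH phi; rewrite mulrA mulr_sumr.
by congr (_ / _); apply: eq_bigr => z _; rewrite IH.
Qed.

Lemma expect_add S T phi :
  expect (S + T) phi = expect S (fun u => expect T (fun v => phi (u ++ v))).
Proof.
elim: S phi => //= S IH phi; congr (_ / _); apply: eq_bigr => z _.
by rewrite IH.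
Qed.

Lemma expect_indep S T phi psi :
  expect (S + T) (fun w => phi (take S w) * psi (drop S w)) =
  expect S phi * expect T psi.
Proof.
rewrite expect_add mulrC -expectZ; apply: eq_expect => u su.
rewrite mulrC -expectZ; apply: eq_expect => v _.
by rewrite -su take_size_cat // drop_size_cat.
Qed.

Lemma expect_all T (a : pred C) :
  expect T (fun w => (all a w)%:R) = ((\sum_z (a z)%:R) / #|C|%:R) ^+ T.
Proof.
elim: T => //= T IH; rewrite exprSr -IH mulrA; congr (_ / _).
rewrite mulr_sumr; apply: eq_bigr => z _; rewrite mulrC -expectZ.
by apply: eq_expect => w _; case: (a z); rewrite ?mul1r ?mul0r.
Qed.

Lemma sum_tuple_cons T (G : T.+1.-tuple C -> K) :
  \sum_w G w = \sum_(z : C) \sum_(w : T.-tuple C) G [tuple of z :: w].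
Proof.
rewrite pair_big /=.
rewrite (reindex (fun p : C * T.-tuple C => [tuple of p.1 :: p.2])) //=.
exists (fun w : T.+1.-tuple C => (thead w, [tuple of behead w])) => [[z w] _|w _] /=.
  by congr pair; apply: val_inj.
by rewrite [w in RHS]tuple_eta.
Qed.

Lemma sum_tuple_expect T phi :
  \sum_(w : T.-tuple C) phi w = expect T phi * #|C|%:R ^+ T.
Proof.
elim: T phi => [|T IH] phi.
  rewrite mulr1 (bigD1 [tuple]) //= big1 ?addr0 // => w.
  by move/eqP; case; apply: tuple0.
rewrite sum_tuple_cons /= exprS mulrA divfK // mulr_suml.
by apply: eq_bigr => z _; rewrite -IH.
Qed.

End Expectation.

(** * Probability that every trial passes *)

Section Rejection.
Context {K : realType} {d : Order.disp_t} {R : orderType d} {n : nat}.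
Variable f : cube n -> R.
Hypothesis n_gt0 : (0 < n)%N.

Lemma card_cube_gt0 : (0 < #|{: cube n}|)%N.
Proof. by apply/card_gt0P; exists [ffun=> false]. Qed.

Lemma card_coinE : #|coin n| = (#|{: cube n}| * n)%N.
Proof. by rewrite card_prod card_ord. Qed.

Lemma card_coin_gt0 : (0 < #|coin n|)%N.
Proof. by rewrite card_coinE muln_gt0 card_cube_gt0. Qed.

Lemma Pr_expect T (A : seq (coin n) -> bool) :
  Pr (K := K) (fun w : T.-tuple (coin n) => A w) = expect T (fun w => (A w)%:R).
Proof.
rewrite /Pr card_tuple -sum1_card natr_sum big_mkcond /=.
rewrite (eq_bigr (fun w : T.-tuple (coin n) => (A w)%:R)) => [|w _]; last first.
  by rewrite /in_mem /=; case: (A w).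
rewrite (sum_tuple_expect card_coin_gt0 T (fun w => (A w)%:R)) natrX mulfK //.
by rewrite expf_neq0 // pnatr_eq0 -lt0n card_coin_gt0.
Qed.

Lemma Pr_eq1 T (A : pred (T.-tuple (coin n))) : (forall w, A w) -> Pr (K := K) A = 1.
Proof.
move=> h; rewrite /Pr (eq_card (B := predT)) => [|w]; last by rewrite !inE /in_mem /= h.
by rewrite divff // pnatr_eq0 card_tuple -lt0n expn_gt0 card_coin_gt0.
Qed.

Lemma eq_Pr T (A B : pred (T.-tuple (coin n))) : A =1 B -> Pr (K := K) A = Pr B.
Proof. by move=> AB; rewrite /Pr (eq_card (B := B)). Qed.

Definition witness_rate i : K :=
  (minn #|increasing_edges f i| #|decreasing_edges f i|)%:R / #|{: cube n}|%:R.

Lemma witness_rate_ge0 i : 0 <= witness_rate i.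
Proof. by rewrite divr_ge0. Qed.

Lemma witness_rate_le1 i : witness_rate i <= 1.
Proof.
rewrite ler_pdivrMr ?ltr0n ?card_cube_gt0 // mul1r ler_nat geq_min.
by rewrite max_card.
Qed.

Lemma sees_none k i (E : {set cube n}) :
  witness_rate i * #|{: cube n}|%:R <= #|E|%:R ->
  expect k (fun w => (~~ sees E w)%:R) <= (1 - witness_rate i) ^+ k.
Proof.
move=> le.
have -> : expect k (fun w => (~~ sees E w)%:R : K) =
    expect k (fun w => (all (fun z : coin n => z.1 \notin E) w)%:R).
  by apply: eq_expect => w _; rewrite /sees -all_predC.
rewrite expect_all.
have cube_gt0 : 0 < #|{: cube n}|%:R :> K by rewrite ltr0n card_cube_gt0.
rewrite (_ : _ / _ = 1 - #|E|%:R / #|{: cube n}|%:R).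
  apply: lerXn2r; rewrite ?nnegrE.
  - by rewrite subr_ge0 ler_pdivrMr // mul1r ler_nat max_card.
  - by rewrite subr_ge0 witness_rate_le1.
  - by rewrite lerD2l lerN2 ler_pdivlMr.
rewrite -(pair_bigA _ (fun x (_ : 'I_n) => (x \notin E)%:R)) /=.
under eq_bigr => x _ do rewrite sumr_const card_ord.
rewrite sumrMnl card_coinE natrM -[_ *+ n]mulr_natr.
rewrite -mulf_div divff ?mulr1 ?pnatr_eq0 -?lt0n //.
suff -> : \sum_(x : cube n) (x \notin E)%:R = #|{: cube n}|%:R - #|E|%:R :> K.
  by rewrite mulrBl divff ?gt_eqF.
rewrite -(cardC E) natrD addrAC subrr add0r -sum1_card natr_sum [RHS]big_mkcond.
by apply: eq_bigr => x _; rewrite !inE; case: (x \in E).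
Qed.

(** A lower bound on the rejection probability of one trial: a union bound on missing either kind of
    edge, truncated at 0 and averaged over directions. *)
Definition detection (k : nat) : K :=
  (\sum_(i < n) Num.max 0 (1 - 2 * (1 - witness_rate i) ^+ k)) / n%:R.

Lemma detection_ge0 k : 0 <= detection k.
Proof. by rewrite divr_ge0 // sumr_ge0 // => i _; rewrite le_max lexx. Qed.

Lemma trial_ok_le k :
  expect k.+1 (fun w => (trial_ok f k w)%:R) <= 1 - detection k.
Proof.
have cube_gt0 : 0 < #|{: cube n}|%:R :> K by rewrite ltr0n card_cube_gt0.
have n0 : 0 < n%:R :> K by rewrite ltr0n.
rewrite /= ler_pdivrMr ?ltr0n ?card_coin_gt0 //.
apply: (@le_trans _ _ (\sum_(z : coin n)
   (1 - Num.max 0 (1 - 2 * (1 - witness_rate z.2) ^+ k)))).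
  apply: ler_sum => z _; rewrite lerBrDr -lerBrDl ge_max; apply/andP; split.
    rewrite subr_ge0 -[leRHS](expect_cst card_coin_gt0 k 1).
    by apply: expect_le => w _; rewrite lern1 leq_b1.
  rewrite lerD2l lerN2 mulr2n mulrDl mul1r.
  apply: le_trans (lerD
    (@sees_none k z.2 (increasing_edges f z.2) _)
    (@sees_none k z.2 (decreasing_edges f z.2) _)).
  - rewrite -expectD; apply: expect_le => w sw; rewrite -{1 2}sw take_size.
    by case: (sees _ _); case: (sees _ _); rewrite /= ?addr0 ?add0r //; lra.
  - by rewrite divfK ?gt_eqF // ler_nat geq_minl.
  - by rewrite divfK ?gt_eqF // ler_nat geq_minr.
rewrite -(pair_bigA _ (fun (_ : cube n) i =>
   1 - Num.max 0 (1 - 2 * (1 - witness_rate i) ^+ k))) /=.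
rewrite sumr_const sumrB sumr_const card_ord card_coinE natrM.
rewrite /detection; set S := \sum_(i < n) _.
rewrite -[leLHS]mulr_natl mulrCA ler_pM2l // mulrBl mul1r divfK //.
by rewrite gt_eqF.
Qed.

(** Trials read disjoint cells, so their probabilities multiply. The induction rests on (1 - r')(1 +
    r' + S) <= 1 + S, where r' is the detection bound of the first trial and S the sum of the
    others. *)
Lemma all_ok_le ks r :
  expect (cells ks + r) (fun w => (all_ok f ks w)%:R) <=
  (1 + \sum_(k <- ks) detection k)^-1 :> K.
Proof.
elim: ks => [|k ks IH].
  rewrite big_nil addr0 invr1 -[leRHS](expect_cst card_coin_gt0 (cells [::] + r) 1).
  exact: expect_le.
rewrite cells_cons -addnA big_cons.
have -> : expect (k.+1 + (cells ks + r)) (fun w => (all_ok f (k :: ks) w)%:R : K) =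
    expect k.+1 (fun w => (trial_ok f k w)%:R) *
    expect (cells ks + r) (fun w => (all_ok f ks w)%:R).
  rewrite -expect_indep; apply: eq_expect => w _ /=.
  by rewrite trial_ok_take // -natrM mulnb.
have a_ge0 : 0 <= expect k.+1 (fun w => (trial_ok f k w)%:R : K).
  rewrite -(expect_cst card_coin_gt0 k.+1 0); apply: expect_le => w _.
  exact: ler0n.
have S_ge0 : 0 <= \sum_(j <- ks) detection j.
  by apply: sumr_ge0 => j _; apply: detection_ge0.
have := trial_ok_le k; have := detection_ge0 k.
move: a_ge0 IH S_ge0.
set a := expect k.+1 _; set b := expect _ _; set S := \sum_(j <- _) _.
set r' := detection k => a0 bS S0 r0 ar.
have S1 : 0 < 1 + S by lra.
have : a * b <= (1 - r') * (1 + S)^-1.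
  apply: le_trans (ler_wpM2l a0 bS) _.
  by rewrite ler_wpM2r // invr_ge0 ltW.
move=> /le_trans; apply.
rewrite ler_pdivrMr // -ler_pdivrMl ?invr_gt0; last by lra.
rewrite invrK; nra.
Qed.

End Rejection.

(** * Running time and choice of scales *)

Section LoopCounts.
Context {K : realType}.
Implicit Types (e B : K).

Lemma ler_nat_pow2 m : m%:R <= 2 ^+ m :> K.
Proof. by rewrite -natrX ler_nat ltnW // ltn_expl. Qed.

(** Stated with a sigma type so that loop counts can be extracted as data. *)
Lemma first_reach (g : nat -> K) B : (exists m, B <= g m) ->
  {m | B <= g m & forall l, (l < m)%N -> g l < B}.
Proof.
move=> ex; have [m Bm min] := ex_minnP ex; exists m => // l.
by rewrite ltnNge ltNge; apply: contra => /min.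
Qed.

Lemma first_multiple e B : 0 < e ->
  {m : nat | B <= m%:R * e & forall l, (l < m)%N -> l%:R * e < B}.
Proof.
move=> e0; apply: first_reach; exists (Num.bound `|B / e|).
rewrite -ler_pdivrMr // (le_trans (ler_norm _)) // ltW //.
exact/archi_boundP.
Qed.

Lemma first_doubling e B : 0 < e ->
  {m : nat | B <= e * 2 ^+ m & forall l, (l < m)%N -> e * 2 ^+ l < B}.
Proof.
move=> e0; apply: first_reach; have [m Bm _] := first_multiple B e0.
by exists m; apply: le_trans Bm _; rewrite mulrC ler_pM2l // ler_nat_pow2.
Qed.

(* Bernoulli gives (1 - m) ^+ k <= 1 / (1 + k m), at most 1/4 once k m >= 3. *)
Lemma detect_half (m : K) k : 0 <= m <= 1 -> 3 <= k%:R * m ->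
  2^-1 <= 1 - 2 * (1 - m) ^+ k.
Proof.
move=> /andP[m0 m1] km.
have h j : (1 - m) ^+ j * (1 + j%:R * m) <= 1 /\ 0 <= (1 - m) ^+ j.
  elim: j => [|j [IH p0]]; first by rewrite expr0 mul0r; lra.
  split; last by rewrite exprn_ge0 // subr_ge0.
  apply: le_trans IH; rewrite exprS -mulrA mulrCA ler_wpM2l //.
  rewrite -natr1; have : 0 <= j%:R :> K by exact: ler0n.
  nra.
have [] := h k; set p := (1 - m) ^+ k; nra.
Qed.

End LoopCounts.

Section Analysis.
Context {K : realType}.
Variables (n : nat) (eps : K).
Hypotheses (n_gt0 : (0 < n)%N) (eps01 : 0 < eps < 1).

Let eps_gt0 : 0 < eps. Proof. by case/andP: eps01. Qed.

(** The factor 128 is reached by doublings and is large enough for [schedule_detects], where 128 /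
    48 >= 2. *)
Definition loop_bound : K := 128 * n%:R.

Lemma level_cost_gt0 t : 0 < eps * 2 ^+ t.
Proof. by rewrite mulr_gt0 // exprn_gt0. Qed.

Definition rep t := s2val (first_multiple loop_bound (level_cost_gt0 t)).
Definition nlevels := s2val (first_doubling loop_bound eps_gt0).
Definition schedule := levels rep 0 nlevels.

Lemma rep_ge t : loop_bound <= (rep t)%:R * (eps * 2 ^+ t).
Proof. exact: (s2valP (first_multiple loop_bound (level_cost_gt0 t))). Qed.

Lemma rep_lt t l : (l < rep t)%N -> l%:R * (eps * 2 ^+ t) < loop_bound.
Proof. exact: (s2valP' (first_multiple loop_bound (level_cost_gt0 t))). Qed.

Lemma nlevels_ge : loop_bound <= eps * 2 ^+ nlevels.
Proof. exact: (s2valP (first_doubling loop_bound eps_gt0)). Qed.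

Lemma nlevels_lt l : (l < nlevels)%N -> eps * 2 ^+ l < loop_bound.
Proof. exact: (s2valP' (first_doubling loop_bound eps_gt0)). Qed.

Lemma big_schedule (g : nat -> K) :
  \sum_(k <- schedule) g k = \sum_(t < nlevels) (rep t)%:R * g (2 ^ t)%N.
Proof.
rewrite /schedule /levels big_flatten big_map -[in LHS](subn0 nlevels).
rewrite big_mkord; apply: eq_bigr => t _.
by rewrite big_nseq iter_addr addr0 mulr_natl.
Qed.

(** Rounding up costs at most one increment [eps * 2 ^+ t], which is below [loop_bound] on every
    executed level; hence twice 128. *)
Lemma rep_cost_le (t : 'I_nlevels) : (rep t)%:R * 2 ^+ t <= 256 * (n%:R / eps).
Proof.
have e_lt : eps * 2 ^+ t < loop_bound by apply: nlevels_lt.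
have p0 : 0 < (2 : K) ^+ t by rewrite exprn_gt0.
rewrite mulrA ler_pdivlMr //.
have : ((rep t).-1)%:R * (eps * 2 ^+ t) < loop_bound.
  case E : (rep t) => [|r] /=; last by apply: rep_lt; rewrite E.
  by rewrite mul0r /loop_bound mulr_gt0 // ltr0n.
have : (rep t)%:R <= (rep t).-1%:R + 1 :> K.
  by rewrite natr1 ler_nat leqSpred.
move: e_lt; rewrite /loop_bound.
set r := (rep t)%:R; set r1 := (rep t).-1%:R; set p := 2 ^+ t => e1 e2 e3.
have : r * (p * eps) <= (r1 + 1) * (p * eps) by rewrite ler_pM2r // mulr_gt0.
rewrite mulrDl mul1r (mulrC p) => h; lra.
Qed.

Lemma ln_ge (y : K) : 0 < y -> 1 - y^-1 <= ln y.
Proof.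
move=> y0; rewrite -[ln y]opprK -lnV ?posrE // lerNr.
have := @le_ln1Dx K (y^-1 - 1); rewrite ltrBrDl subrr invr_gt0 => /(_ y0).
by rewrite addrC subrK => h; apply: le_trans h _; rewrite opprB.
Qed.

Let y := n%:R / eps.

Lemma ratio_gt1 : 1 < y.
Proof.
rewrite /y ltr_pdivlMr // mul1r; apply: (@lt_le_trans _ _ 1).
  by case/andP: eps01.
by rewrite ler1n.
Qed.

(** The last level l satisfies 2^l <= 2^7 y; take logarithms and use ln 2 >= 1/2. *)
Lemma nlevels_le : nlevels%:R <= 8 + 2 * ln y.
Proof.
have y1 := ratio_gt1; have lny : 0 <= ln y by rewrite ln_ge0 // ltW.
have y0 : 0 < y by apply: lt_trans y1.
have ln2 : 2^-1 <= ln 2 :> K.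
  have two_gt0 : 0 < 2 :> K by [].
  by have := ln_ge two_gt0; lra.
case E : nlevels => [|l]; first by lra.
have : eps * 2 ^+ l < loop_bound by apply: nlevels_lt; rewrite E.
rewrite /loop_bound -ltr_pdivlMl // => h.
have two_pow j : 0 < (2 : K) ^+ j by rewrite exprn_gt0.
have : 2 ^+ l <= 2 ^+ 7 * y.
  apply: ltW; apply: lt_le_trans h _; rewrite /y le_eqVlt; apply/orP; left.
  by apply/eqP; ring.
move=> le.
have : ln (2 ^+ l) <= ln (2 ^+ 7 * y).
  by rewrite ler_ln ?posrE ?(mulr_gt0 (two_pow _) y0) ?two_pow.
rewrite (lnM (two_pow 7%N) y0).
rewrite !lnXn // -[ln 2 *+ l]mulr_natl -[ln 2 *+ 7]mulr_natl -natr1.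
have : 0 <= l%:R :> K by [].
move: ln2 lny; set a := ln 2; set b := ln y => ln2 lny l0 lel.
case: (leP (l%:R : K) 7) => l7; first lra.
have : (l%:R - 7) * 2^-1 <= (l%:R - 7) * a by rewrite ler_wpM2l // subr_ge0 ltW.
rewrite mulrBl; lra.
Qed.

Lemma schedule_cost_le :
  (schedule_cost schedule)%:R <= 22 * 256 * y * nlevels%:R.
Proof.
have -> : (schedule_cost schedule)%:R = \sum_(k <- schedule) (12 * k + 10)%:R :> K.
  by elim: schedule => [|k ks IH]; rewrite ?big_nil ?big_cons //= natrD IH.
rewrite big_schedule.
have term (t : 'I_nlevels) :
    true -> (rep t)%:R * (12 * 2 ^ t + 10)%:R <= 22 * 256 * y :> K.
  move=> _; have := rep_cost_le t; rewrite -/y -natrX -natrM.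
  have : (rep t * (12 * 2 ^ t + 10) <= 22 * (rep t * 2 ^ t))%N.
    have : (0 < 2 ^ t)%N by rewrite expn_gt0.
    nia.
  by rewrite -natrM -(ler_nat K) [X in _ <= X -> _]natrM; lra.
apply: le_trans (ler_sum _ term) _.
by rewrite sumr_const card_ord -[leLHS]mulr_natr.
Qed.

(** Each level costs O(y). Terms linear in y are absorbed by y - 1 <= y ln y; the added 1 covers y
    near 1, where y ln y vanishes. *)
Lemma time_le :
  (schedule_cost schedule + 5 * nlevels + 11)%:R <= 60 * 1000 * (1 + y * ln y).
Proof.
have y1 := ratio_gt1; have lny : 0 <= ln y by rewrite ln_ge0 // ltW.
have := schedule_cost_le; have := nlevels_le.
have : y - 1 <= y * ln y.
  have := ln_ge (lt_trans ltr01 y1); rewrite -(ler_pM2l (lt_trans ltr01 y1)).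
  by rewrite mulrBr divff ?mulr1 // gt_eqF // (lt_trans ltr01).
have m0 : 0 <= nlevels%:R :> K by [].
have : ln y <= y * ln y by nra.
rewrite (natrD _ _ 11) (natrD _ _ (5 * _)) (natrM _ 5); move: lny m0.
set m := nlevels%:R; set a := ln y; set s := (schedule_cost _)%:R.
move=> a0 m0 l1 l2 l3 l4.
have : y * m <= y * (8 + 2 * a) by rewrite ler_wpM2l //; lra.
rewrite mulrDr; lra.
Qed.

Section Detection.
Context {d : Order.disp_t} {R : orderType d}.
Variable f : cube n -> R.

(** Let m be the rate and t the least scale with 3 <= m 2^t. Then m 2^t <= 6, so the term of t alone
    is at least 2^-t / 2 >= m / 12. Rates up to eps / (4 n) are given up: the left-hand side is then
    at most 0. *)
Lemma detection_direction i :
  (witness_rate f i - eps / (4 * n%:R)) / 12 <=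
  \sum_(t < nlevels) (2 ^+ t)^-1 *
     Num.max 0 (1 - 2 * (1 - witness_rate f i) ^+ (2 ^ t)) :> K.
Proof.
have terms_ge0 (t : 'I_nlevels) : true -> 0 <= (2 ^+ t)^-1 *
    Num.max 0 (1 - 2 * (1 - witness_rate f i) ^+ (2 ^ t)) :> K.
  by move=> _; rewrite mulr_ge0 ?le_max ?lexx // invr_ge0 exprn_ge0.
have n0 : 0 < n%:R :> K by rewrite ltr0n.
case: (leP (witness_rate f i) (eps / (4 * n%:R))) => small.
  apply: (@le_trans _ _ 0); last exact: sumr_ge0.
  lra.
set m := witness_rate f i in small terms_ge0 *.
have m1 : 0 <= m <= 1 by rewrite witness_rate_ge0 witness_rate_le1.
have m0 : 0 < m by apply: le_lt_trans small; rewrite divr_ge0 ?mulr_ge0 // ltW.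
have [t t3 tmin] := first_doubling 3 m0.
have t6 : m * 2 ^+ t <= 6.
  case: t t3 tmin => [|t] _ tmin; first by rewrite mulr1; lra.
  by have := tmin t (ltnSn _); rewrite exprS; lra.
have small' : eps < m * (4 * n%:R) by rewrite -ltr_pdivrMr // mulr_gt0.
have p0 : 0 < (2 : K) ^+ t by rewrite exprn_gt0.
(* Otherwise 128 n <= eps 2^t <= 4 n m 2^t <= 24 n. *)
have tl : (t < nlevels)%N.
  rewrite ltnNge; apply/negP => lt.
  have := nlevels_ge; rewrite /loop_bound.
  have : eps * 2 ^+ nlevels <= eps * 2 ^+ t.
    by rewrite ler_pM2l // ler_eXn2l // ltr1n.
  have : eps * 2 ^+ t <= m * (4 * n%:R) * 2 ^+ t by rewrite ler_pM2r // ltW.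
  have : m * 2 ^+ t * n%:R <= 6 * n%:R by rewrite ler_pM2r.
  move: n0; lra.
rewrite (bigD1 (Ordinal tl)) //=; apply: ler_wpDr.
  by apply: sumr_ge0 => j _; apply: terms_ge0.
have half : 2^-1 <= Num.max 0 (1 - 2 * (1 - m) ^+ (2 ^ t)).
  by rewrite le_max; apply/orP; right; apply: detect_half; rewrite // natrX mulrC.
apply: (@le_trans _ _ ((2 ^+ t)^-1 * 2^-1)); last by rewrite ler_pM2l // invr_gt0.
rewrite -(ler_pM2l p0) mulVKf ?gt_eqF //.
have : 0 <= eps / (4 * n%:R) by rewrite divr_ge0 ?mulr_ge0 // ltW.
set x := eps / _ => x0.
have : 0 <= 2 ^+ t * x by rewrite mulr_ge0 // ltW.
move: t6; rewrite mulrC; lra.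
Qed.

(** After exchanging the sums over scales and directions, the total is at least (128 / eps)(eps / 2
    - eps / 4) / 12 = 8 / 3. *)
Lemma schedule_detects : unate_far eps f ->
  2 <= \sum_(k <- schedule) detection (K := K) f k.
Proof.
move=> /unate_far_edges far0.
have far : eps / 2 <= \sum_(i < n) witness_rate f i by [].
have n0 : 0 < n%:R :> K by rewrite ltr0n.
rewrite big_schedule.
apply: (@le_trans _ _ (\sum_(t < nlevels) 128 / eps * ((2 ^+ t)^-1 *
   \sum_(i < n) Num.max 0 (1 - 2 * (1 - witness_rate f i) ^+ (2 ^ t))))); last first.
  apply: ler_sum => t _; rewrite /detection.
  have : 0 <= \sum_(i < n) Num.max 0 (1 - 2 * (1 - witness_rate f i) ^+ (2 ^ t)) :> K.
    by apply: sumr_ge0 => i _; rewrite le_max lexx.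
  set S := \sum_(i < n) _ => S0.
  have p0 : 0 < (2 : K) ^+ t by rewrite exprn_gt0.
  rewrite [_ / n%:R]mulrC !mulrA ler_wpM2r // ler_pdivlMr //.
  rewrite (_ : _ * n%:R = loop_bound / (eps * 2 ^+ t)); last first.
    by rewrite /loop_bound invfM; ring.
  by rewrite ler_pdivrMr ?level_cost_gt0 // rep_ge.
rewrite -mulr_sumr.
under eq_bigr => t _ do rewrite mulr_sumr.
rewrite exchange_big /=.
apply: (@le_trans _ _ (128 / eps *
   \sum_(i < n) ((witness_rate f i - eps / (4 * n%:R)) / 12))).
  rewrite -mulr_suml sumrB sumr_const card_ord.
  rewrite (_ : _ *+ n = eps / 4); last first.
    rewrite -[LHS]mulr_natr; field.
    by rewrite gt_eqF.
  rewrite mulrAC ler_pdivlMr //; move: far; set S := \sum_(i < n) witness_rate f i.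
  by move: eps_gt0; lra.
rewrite ler_pM2l ?divr_gt0 //; apply: ler_sum => i _.
exact: detection_direction.
Qed.

Let ks_cells : (cells schedule <= schedule_cost schedule)%N.
Proof. exact: cells_le_cost. Qed.

Lemma run_tester T (w : T.-tuple (coin n)) :
  (schedule_cost schedule + 5 * nlevels + 11 <= T)%N ->
  [/\ halted (run tester eps f w),
      asked (run tester eps f w) = all_queries schedule w &
      num (run tester eps f w) 0 = (all_ok f schedule w)%:R].
Proof.
move=> costT.
have sz : size (take (cells schedule) w) = cells schedule.
  by rewrite size_takel // size_tuple (leq_trans ks_cells) // (leq_trans _ costT) //; lia.
have ex : exec f (init tester eps w) (schedule_cost schedule + 5 * nlevels + 11)
    (fun s => at_point s [::] (drop (cells schedule) w)
                (all_queries schedule (take (cells schedule) w)) /\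
              num s 0 = (all_ok f schedule (take (cells schedule) w))%:R).
  (* Ten initial instructions, plus the failing guard of the outer loop. *)
  rewrite (_ : (_ + 11)%N = (schedule_cost schedule + 5 * nlevels).+1.+4.+4.+2);
    last by lia.
  rewrite /init; do 10!(apply: exec_step; rewrite /=).
  apply: (@exec_levels _ _ _ _ f loop_bound eps rep rep_lt rep_ge nlevels _ 0%N true
    (take (cells schedule) w) (drop (cells schedule) w) [::]) => //=.
  - by split; rewrite //= cat_take_drop.
  - by rewrite expr0 mulr1.
  - by rewrite /loop_bound; ring.
  - exact: nlevels_lt.
  - exact: nlevels_ge.
case: ex => j jle [[code_s _ asked_s] num_s].
(* A halted state is fixed by [step], so running on to time T changes nothing. *)
have stop s m : code s = [::] -> iter m (step f) s = s.
  by move=> hs; elim: m => //= m ->; case: s hs => c0 w0 q0 nm dr px an /= ->.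
have -> : run tester eps f w = iter j (step f) (init tester eps w).
  rewrite /run; have := subnK (leq_trans jle costT).
  by move: (init _ _ _) code_s => s code_s <-; rewrite iterD stop.
split; first by rewrite /halted code_s.
  by rewrite asked_s all_queries_take.
by rewrite num_s all_ok_take.
Qed.

Lemma all_ok_unate ks w : unate f -> all_ok f ks w.
Proof.
move=> uf; elim: ks w => //= k ks IH w; rewrite IH andbT.
case: w => //= z w; apply/negP => /andP[/hasP[x _ xi] /hasP[x' _ xd]].
exact: unate_edges uf xi xd.
Qed.

End Detection.
End Analysis.

Theorem theorem1 (K : realType) (d : Order.disp_t) (R : orderType d) :
  exists (P : seq cmd) (T : nat -> K -> nat),
    (exists C : K, forall (n : nat) (eps : K), (0 < n)%N -> 0 < eps < 1 ->
       (T n eps)%:R <= C * (1 + n%:R / eps * ln (n%:R / eps)))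
    /\
    (forall (n : nat) (eps : K), (0 < n)%N -> 0 < eps < 1 ->
       [/\ runs_in_time R P n eps (T n eps),
           nonadaptive R P n eps (T n eps),
           one_sided R P n eps (T n eps)
         & rejects_far R P n eps (T n eps)]).
Proof.
pose L n (eps : K) := 60 * 1000 * (1 + n%:R / eps * ln (n%:R / eps)).
have L_ge0 n eps : (0 < n)%N -> 0 < eps < 1 -> 0 <= L n eps.
  by move=> n0 eps01; apply: le_trans (time_le n0 eps01).
(* The exact cost depends on a proof of [0 < eps < 1]; the integer part of its explicit bound is a
   function of [n] and [eps] alone. *)
exists tester, (fun n eps => Num.truncn (L n eps)); split.
  by exists (60 * 1000) => n eps n0 eps01; rewrite truncn_le L_ge0.
move=> n eps n0 eps01; set T := Num.truncn _.
have costT : (schedule_cost (schedule n eps01) + 5 * nlevels n eps01 + 11 <= T)%N.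
  by rewrite truncn_ge_nat ?L_ge0 // time_le.
have spec (f : cube n -> R) w := run_tester n0 f w costT.
split.
- by move=> f w; case: (spec f w).
- by move=> f g w; have [_ -> _] := spec f w; have [_ -> _] := spec g w.
- move=> f uf; apply: (Pr_eq1 n0) => w; have [h _ e] := spec f w.
  by rewrite /accepts h e all_ok_unate ?eqxx.
move=> f far; have := schedule_detects n0 eps01 far.
have cellsT : (cells (schedule n eps01) <= T)%N.
  by apply: leq_trans costT; have := cells_le_cost (schedule n eps01); lia.
have := all_ok_le (K := K) f n0 (schedule n eps01) (T - cells (schedule n eps01)).
rewrite subnKC //.
set S := \sum_(k <- _) _ => okS S2.
rewrite (eq_Pr (B := fun w : T.-tuple _ => ~~ all_ok f (schedule n eps01) w));
  last first => [w|].
  have [h _ e] := spec f w; rewrite /rejects h e.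
  by case: (all_ok _ _ _); rewrite /= ?eqxx // eq_sym oner_eq0.
rewrite (Pr_expect n0 T (fun w => ~~ all_ok f (schedule n eps01) w)).
(* The detection sum is at least 2, so all trials pass with probability at most 1 / (1 + 2). *)
have : expect T (fun w => (all_ok f (schedule n eps01) w)%:R) <= 3^-1 :> K.
  apply: le_trans okS _; rewrite lef_pV2 ?posrE; lra.
have : expect T (fun w => (~~ all_ok f (schedule n eps01) w)%:R) +
       expect T (fun w => (all_ok f (schedule n eps01) w)%:R) = 1 :> K.
  rewrite -expectD -[RHS](expect_cst (card_coin_gt0 n0) T 1).
  by apply: eq_expect => w _; case: (all_ok _ _ _); rewrite ?addr0 ?add0r.
lra.
Qed.
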